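(* Let $\eta$ be a simple max-stable process on $\mathcal{X}$ with the spectral representation given in the context, with spectral process $Y$, and let $s_1,\ldots,s_k\in\mathcal{X}$, $k\ge2$. Then the extremal concurrence probability satisfies $$p(s_1,\ldots,s_k)=\mathbb{E}_Y\left(\left[\mathbb{E}_{\tilde Y}\left\{\max_{j=1,\ldots,k}\frac{\tilde Y(s_j)}{Y(s_j)}\right\}\right]^{-1}\right),$$ where $Y$ and $\tilde Y$ are independent copies of the spectral process, $\mathbb{E}_{\tilde Y}$ denotes expectation with respect to $\tilde Y$ only (with $Y$ held fixed), and $\mathbb{E}_Y$ denotes expectation with respect to $Y$.
   Context: $\mathcal{X}\subset\mathbb{R}^d$, $d\ge1$, is a compact set. Simple max-stable process: $\eta(s)=\max_{i\ge1}\zeta_iY_i(s)=\max_{\varphi\in\Phi}\varphi(s)$, $s\in\mathcal{X}$, where $\{\zeta_i\colon i\ge1\}$ are the points of a Poisson process on $(0,\infty)$ with intensity $\zeta^{-2}\,d\zeta$, the $Y_i$ are independent copies (independent of $\{\zeta_i\}$) of a non-negative stochastic process $Y$ on $\mathcal{X}$ (the spectral process) with continuous sample paths, $\mathbb{E}\{Y(s)\}=1$ for all $s\in\mathcal{X}$ and $\mathbb{E}\{\sup_{s\in\mathcal{X}}Y(s)\}<\infty$; $\Phi=\{\varphi_i=\zeta_iY_i\colon i\ge1\}$. Extremal concurrence probability: $p(s_1,\ldots,s_k)=\mathbb{P}\{\text{for some }\ell\ge1\colon \eta(s_j)=\varphi_\ell(s_j),\ j=1,\ldots,k\}$. Conventions: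 $0/0=0$, $a/0=\infty$ if $a>0$, and $1/\infty=0$. *)

(* Defs.v *)
From HB Require Import structures.
From mathcomp Require Export all_boot all_order all_algebra.
From mathcomp Require Export all_classical all_reals all_analysis.
From mathcomp Require Export finmap measurable_realfun.

Set Implicit Arguments.
Unset Strict Implicit.
Unset Printing Implicit Defensive.

Import Order.TTheory GRing.Theory Num.Theory.
Import numFieldNormedType.Exports.

Local Open Scope classical_set_scope.
Local Open Scope ring_scope.
Local Open Scope ereal_scope.

Definition sigma_gen (T I : Type) (d' : measure_display) (S : measurableType d')
    (D : set I) (Z : I -> T -> S) : set (set T) :=
  <<s \bigcup_(i in D) preimage_set_system setT (Z i) measurable >>.

Definition mutually_independent (R : realType) (d : measure_display)
    (T : measurableType d) (P : probability T R) (I : choiceType)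
    (F : I -> set (set T)) : Prop :=
  forall (J : {fset I}) (E : I -> set T), (forall i, i \in J -> F i (E i)) ->
    P (\bigcap_(i in [set` J]) E i) = \prod_(i <- J) P (E i).

Definition independent_classes (R : realType) (d : measure_display)
    (T : measurableType d) (P : probability T R) (F G : set (set T)) : Prop :=
  forall A B : set T, F A -> G B -> P (A `&` B) = P A * P B.

(* Points are counted with multiplicity. *)
Definition point_count (R : realType) (T : Type) (x : nat -> T -> R)
    (A : set R) (w : T) : \bar R :=
  \sum_(0 <= i <oo) \d_(x i w) A.

(* The second argument of poisson_prob is a dummy; poisson_prob 0 is the Dirac
   mass at 0. *)
Definition poisson_distributed (R : realType) (d : measure_display)
    (T : measurableType d) (P : probability T R) (N : T -> \bar R)
    (m : \bar R) : Prop :=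
  match m with
  | r%:E => forall n : nat,
      P [set w | N w = n%:R%:E] = poisson_prob r 0%N [set n]
  | _ => P [set w | N w = +oo] = 1
  end.

(* The x i enumerate, in an arbitrary measurable way, the points of a Poisson
   process on E with intensity (density) f with respect to Lebesgue measure. *)
Definition poisson_process (R : realType) (d : measure_display)
    (T : measurableType d) (P : probability T R) (E : set R)
    (f : R -> R) (x : nat -> T -> R) : Prop :=
  [/\ forall i, measurable_fun setT (x i),
      forall i w, E (x i w),
      forall A : set R, measurable A -> A `<=` E ->
        poisson_distributed P (point_count x A)
          (\int[lebesgue_measure]_(z in A) (f z)%:E)
    & forall (n : nat) (A : 'I_n -> set R),
        (forall i, measurable (A i)) -> (forall i, A i `<=` E) ->
        trivIset setT A ->
        mutually_independent P
          (fun i => sigma_gen setT (fun _ : unit => point_count x (A i)))].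

Definition nonneg_continuous_process (R : realType) (dim : nat)
    (X : set 'rV[R]_dim) (d : measure_display) (T : measurableType d)
    (Y : 'rV[R]_dim -> T -> R) : Prop :=
  [/\ forall s, X s -> measurable_fun setT (Y s),
      forall s w, X s -> (0 <= Y s w)%R
    & forall w, {within X, continuous (fun s => Y s w)}].

Definition spectral_process (R : realType) (dim : nat) (X : set 'rV[R]_dim)
    (d : measure_display) (T : measurableType d) (Q : probability T R)
    (Y : 'rV[R]_dim -> T -> R) : Prop :=
  [/\ nonneg_continuous_process X Y,
      forall s, X s -> 'E_Q[Y s] = 1
    & \int[Q]_w ereal_sup [set (Y s w)%:E | s in X] < +oo].

(* Equality of the laws of the paths on the product sigma-algebra generated by
   the evaluations at the points of X. *)
Definition same_law (R : realType) (dim : nat) (X : set 'rV[R]_dim)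
    (d1 : measure_display) (T1 : measurableType d1) (P1 : probability T1 R)
    (Y1 : 'rV[R]_dim -> T1 -> R)
    (d2 : measure_display) (T2 : measurableType d2) (P2 : probability T2 R)
    (Y2 : 'rV[R]_dim -> T2 -> R) : Prop :=
  forall C : set ('rV[R]_dim -> R),
    sigma_gen X (fun s (y : 'rV[R]_dim -> R) => y s) C ->
    P1 [set w | C (Y1 ^~ w)] = P2 [set w | C (Y2 ^~ w)].

(* The copy may live on another probability space; two processes carried by
   different factors of a product space are independent, and integrating over
   one factor is taking the expectation with respect to that process only. *)
Definition is_copy (R : realType) (dim : nat) (X : set 'rV[R]_dim)
    (d1 : measure_display) (T1 : measurableType d1) (P1 : probability T1 R)
    (Y1 : 'rV[R]_dim -> T1 -> R)
    (d2 : measure_display) (T2 : measurableType d2) (P2 : probability T2 R)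
    (Y2 : 'rV[R]_dim -> T2 -> R) : Prop :=
  nonneg_continuous_process X Y1 /\ same_law X P1 Y1 P2 Y2.

Definition spectral_representation (R : realType) (dim : nat)
    (X : set 'rV[R]_dim)
    (d : measure_display) (Omega : measurableType d) (P : probability Omega R)
    (zeta : nat -> Omega -> R) (Ys : nat -> 'rV[R]_dim -> Omega -> R)
    (d' : measure_display) (T : measurableType d') (Q : probability T R)
    (Y : 'rV[R]_dim -> T -> R) : Prop :=
  [/\ poisson_process P `]0%R, +oo[ (fun z => z ^- 2)%R zeta,
      forall i, is_copy X P (Ys i) Q Y,
      mutually_independent P
        (fun i => sigma_gen X (fun s w => Ys i s w))
    & independent_classes P
        (sigma_gen setT (fun i w => zeta i w))
        (sigma_gen (setT `*` X)
           (fun (p : nat * 'rV[R]_dim) w => Ys p.1 p.2 w))].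

Definition extremal_function (R : realType) (dim : nat) (T : Type)
    (zeta : nat -> T -> R) (Ys : nat -> 'rV[R]_dim -> T -> R)
    (i : nat) (s : 'rV[R]_dim) (w : T) : R :=
  (zeta i w * Ys i s w)%R.

(* The maximum over i is written as a supremum in \bar R, which makes eta total;
   under the hypotheses of spectral_representation it is almost surely finite
   and attained. *)
Definition max_stable_process (R : realType) (dim : nat) (T : Type)
    (zeta : nat -> T -> R) (Ys : nat -> 'rV[R]_dim -> T -> R)
    (s : 'rV[R]_dim) (w : T) : \bar R :=
  ereal_sup (range (fun i => (extremal_function zeta Ys i s w)%:E)).

Definition concurrence_probability (R : realType) (dim : nat)
    (d : measure_display) (T : measurableType d) (P : probability T R)
    (zeta : nat -> T -> R) (Ys : nat -> 'rV[R]_dim -> T -> R)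
    (k : nat) (s : 'I_k -> 'rV[R]_dim) : \bar R :=
  P [set w | exists l : nat, forall j : 'I_k,
       max_stable_process zeta Ys (s j) w
       = (extremal_function zeta Ys l (s j) w)%:E].

(* Main.v *)
(** Fix a mesh [dl] and split (0, +oo) into the cells (1/((n+1) dl), 1/(n dl)],
    each of mass [dl] for z^-2 dz, so that the cell counts are independent Poisson
    variables with mean [dl]. If the l-th point lies in cell m, then its being
    extremal at all the s_j is squeezed between the events "for every i <> l in cell
    n, m Y_i <= (n+1) Y_l" and "for every i <> l in cell n, (m+1) Y_i <= n Y_l" at the
    s_j, which see the points only through their cells. Given Y_l = f,
    the probability of such an event, summed over l, is the expectation of
    N_m h_m^(N_m - 1) prod_(n <> m) h_n^(N_n), that is dl exp(- dl sum_n (1 - h_n)),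
    where h_n is the probability that Y satisfies the comparison with f in cell n.
    The layer-cake sum of the 1 - h_n differs from m E max_j (Y(s_j) / f(s_j)) by a
    bounded amount, so the geometric series in m is 1 / E max up to factors exp(O(dl))
    and terms O(dl), and dl tends to 0. In the lower bound
    (where Y_l > 0 at the s_j) the l-th point beats all the others strictly, so these
    events are disjoint in l and ties need no separate argument. *)
From HB Require Import structures.
Require Import Defs.
From mathcomp Require Import all_boot all_order all_algebra.
From mathcomp Require Import all_classical all_reals all_analysis.
From mathcomp Require Import ring lra.
Import Order.TTheory GRing.Theory Num.Theory.
Import numFieldNormedType.Exports.
Local Open Scope classical_set_scope.
Local Open Scope ring_scope.
Local Open Scope ereal_scope.

Set Implicit Arguments.
Unset Strict Implicit.
Unset Printing Implicit Defensive.

(** * Independence: integrating out one of two independent random elements *)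

Section decoupling.
Context (R : realType) (d d1 d2 : measure_display) (T : measurableType d)
  (S1 : measurableType d1) (S2 : measurableType d2).
Variables (P : probability T R) (P1 : probability S1 R) (X1 : T -> S1) (X2 : T -> S2).
Hypotheses (mX1 : measurable_fun setT X1) (mX2 : measurable_fun setT X2).

Lemma measurable_section_prob (E : set (S1 * S2)) : measurable E ->
  measurable_fun setT (fun x => P [set w | E (x, X2 w)]).
Proof.
move=> mE; pose X2' : {mfun T >-> S2} := HB.pack X2 (isMeasurableFun.Build _ _ _ _ _ mX2).
have := measurable_fun_xsection (distribution P X2') mE.
by apply: eq_measurable_fun => x _ /=; rewrite /pushforward/=; congr (P _);
  apply/seteqP; split => w; rewrite /= xsectionE.
Qed.

(** The joint law of [X1] and [X2] agrees with the product of [P1] and the law of [X2] on measurable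
    rectangles, hence everywhere, and the product measure of [E] is the integral of its sections.
    [P1] is only required to be the law of [X1] through the rectangles, so it may be presented on a
    different source. *)
Lemma prob_decouple (E : set (S1 * S2)) :
    (forall A B, measurable A -> measurable B ->
      P (X1 @^-1` A `&` X2 @^-1` B) = P1 A * P (X2 @^-1` B)) ->
    measurable E ->
  P [set w | E (X1 w, X2 w)] = \int[P1]_x P [set w | E (x, X2 w)].
Proof.
move=> XI mE.
pose X2' : {mfun T >-> S2} := HB.pack X2 (isMeasurableFun.Build _ _ _ _ _ mX2).
have mX : measurable_fun setT (fun w => (X1 w, X2 w)) by exact/measurable_fun_pair.
pose X : {mfun T >-> (S1 * S2)%type} :=
  HB.pack (fun w => (X1 w, X2 w)) (isMeasurableFun.Build _ _ _ _ _ mX).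
transitivity (distribution P X E); first by [].
rewrite -(@product_measure_unique _ _ _ _ _ P1 (distribution P X2')) //.
by apply: eq_integral => x _ /=; rewrite /pushforward/=; congr (P _);
  apply/seteqP; split => w; rewrite /= xsectionE.
Qed.

End decoupling.

(** Uniqueness of finite measures on a pi-system: [B] maps to [P (A]&[B)] and to [P A * P B], two
    finite measures that agree on [G], which contains the whole space. *)
Lemma indep_g_sigma (R : realType) d (T : measurableType d) (P : probability T R)
    (A : set T) (G : set (set T)) :
    measurable A -> G `<=` measurable -> G setT -> setI_closed G ->
    (forall B, G B -> P (A `&` B) = P A * P B) ->
  forall B, <<s G >> B -> P (A `&` B) = P A * P B.
Proof.
move=> mA mG GT GI AG.
(* Scaling [P] by the real number [P A] presents the product as a genuine measure. *)
pose r : {nonneg R} := NngNum (fine_ge0 (measure_ge0 P A)).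
have rE : (r%:num)%:E = P A by rewrite fineK// fin_num_measure.
have rP B : mscale r P B = P A * P B by rewrite -rE.
move=> B GB; rewrite -rP setIC.
apply: (@g_sigma_algebra_measure_unique _ _ _ G mG (fun=> setT) (fun=> GT) _
  (mrestr P mA) (mscale r P) GI) => //.
- by rewrite bigcup_const.
- by move=> C GC; rewrite [RHS]rP -AG// setIC.
- by move=> n; apply: le_lt_trans (probability_le1 P (measurableI _ _ _ mA)) (ltry 1%R).
Qed.

(** * The intensity z^-2 and a grid of cells of equal mass *)

Lemma measurable_invsqr (R : realType) (D : set R) : measurable D ->
  D `<=` `]0%R, +oo[ -> measurable_fun D (fun z : R => z ^- 2)%R.
Proof.
move=> mD D0; apply: (@eq_measurable_fun _ _ _ _ _ (fun z : R => z `^ (- 2%:R))%R).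
  move=> x /[!inE] /D0; rewrite /= in_itv/= andbT => x0.
  by rewrite powR_invn// ltW.
by apply: measurable_funTS; exact: measurable_powR.
Qed.

Lemma integral_invsqr_tail (R : realType) (a : R) : (0 < a)%R ->
  \int[lebesgue_measure]_(z in `]a, +oo[) (z ^- 2)%:E = (a^-1)%:E.
Proof.
move=> a0; pose F (x : R) : R := (- x^-1)%R.
have x0 (x : R) : (a <= x)%R -> x != 0%R by move=> ax; rewrite gt_eqF// (lt_le_trans a0).
have dF (x : R) : (a <= x)%R -> is_derive x 1%R F (x ^- 2)%R.
  move=> /x0 {}x0.
  have idx : is_derive x 1%R (id : R -> R) 1%R by exact: is_derive_id.
  apply: is_derive_eq (is_deriveN (@is_deriveV _ id x 1%R 1%R x0 idx)) _.
  by rewrite /GRing.scale/= mulr1 opprK.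
have cf : {within `[a, +oo[, continuous (fun z : R => z ^- 2)%R}.
  apply: continuous_in_subspaceT => x; rewrite inE/= in_itv/= andbT => /x0 ax.
  apply: (@continuousV _ _ (fun z : R => z ^+ 2)%R); first by rewrite expf_neq0.
  exact: exprn_continuous.
rewrite integral_itv_obnd_cbnd; last first.
  apply/measurable_EFinP; apply: measurable_invsqr => //.
  by apply: subset_itv; rewrite ?bnd_simp// ltW.
rewrite (@ge0_continuous_FTC2y _ _ F a 0%R) //.
- by rewrite /F EFinN oppeK add0e.
- by move=> x ax; rewrite invr_ge0 exprn_ge0// ltW// (lt_le_trans a0).
- rewrite -oppr0; apply: cvgN; apply/(@gtr0_cvgV0 _ _ _ _ id) => //.
  by apply: nbhs_pinfty_gt; exact: num_real.
- by move=> x /ltW /dF [].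
- by apply: cvg_at_right_filter; apply: differentiable_continuous; apply/derivable1_diffP;
  have [] := dF _ (lexx a).
- move=> x; rewrite in_itv/= andbT => /ltW /dF ?.
  by rewrite derive1E; exact: derive_val.
Qed.

Lemma measurable_inve (R : realType) d (T : measurableType d) (f : T -> \bar R) :
  measurable_fun setT f -> (forall x, 0 <= f x) ->
  measurable_fun setT (fun x => (f x)^-1).
Proof.
move=> mf f0.
have -> : (fun x => (f x)^-1) = (fun x => if f x == +oo then 0 else
    if f x == 0 then +oo else ((fine (f x)) `^ (-1))%:E).
  apply/funext => x; move: (f0 x); case: (f x) => [r||]//=.
  rewrite lee_fin => r0; rewrite inver eqe; case: ifPn => // _.
  by rewrite powR_inv1.
have me (y : \bar R) : measurable_fun setT (fun x => f x == y).
  apply: (measurable_fun_bool true); rewrite setTI.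
  by rewrite (_ : _ @^-1` _ = f @^-1` [set y]); [rewrite -[X in measurable X]setTI; exact: mf|
    apply/seteqP; split => x /= /eqP].
apply: measurable_fun_ifT => //; apply: measurable_fun_ifT => //.
apply/measurable_EFinP; apply: (measurableT_comp (measurable_powR _)).
exact: measurableT_comp.
Qed.

(* The cell ]1 / (n.+1 dl), 1 / (n dl)], multiplied out so that n = 0 gives the
   unbounded cell ]1 / dl, +oo[. *)
Definition grid (R : realType) (dl : R) (n : nat) : set R :=
  [set x | (0 < x /\ n%:R * dl * x <= 1 /\ 1 < n.+1%:R * dl * x)%R].

Section grid.
Context (R : realType) (dl : R).
Hypothesis dl0 : (0 < dl)%R.

Lemma gridE n : grid dl n = `]((n.+1%:R * dl)^-1)%R, +oo[ `\`
  (if n == 0%N then set0 else `](n%:R * dl)^-1%R, +oo[%classic).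
Proof.
have k0 m : (0 < m.+1%:R * dl)%R by rewrite mulr_gt0.
apply/seteqP; split => x /=; rewrite in_itv/= andbT.
- move=> [x0 [nx xn]]; split; first by rewrite -div1r ltr_pdivrMr// mulrC.
  case: n nx xn => [_ _ []|n] nx xn; rewrite /= in_itv/= andbT; apply/negP.
  by rewrite -leNgt -div1r ler_pdivlMr// mulrC.
- move=> [nx xn]; have x0 : (0 < x)%R by rewrite (lt_trans _ nx)// invr_gt0.
  split => //; split; last by move: nx; rewrite -div1r ltr_pdivrMr// mulrC.
  case: n nx xn => [|n]/= nx; first by rewrite !mul0r.
  by rewrite in_itv/= andbT => /negP; rewrite -leNgt -div1r ler_pdivlMr// mulrC.
Qed.

Lemma measurable_grid n : measurable (grid dl n).
Proof. by rewrite gridE; apply: measurableD => //; case: ifP. Qed.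

Lemma sub_grid n : grid dl n `<=` `]0%R, +oo[.
Proof. by move=> x [x0 _]; rewrite /= in_itv/= andbT. Qed.

Lemma grid_uniq m n x : grid dl m x -> grid dl n x -> m = n.
Proof.
wlog mn : m n / (m <= n)%N.
  by move=> H; have [mn|/ltnW nm] := leqP m n => mx nx; [exact: H|apply/esym/H].
move=> [x0 [_ mx]] [_ [nx _]]; apply/eqP; rewrite eqn_leq mn/= -ltnS.
have : (n%:R * dl * x < m.+1%:R * dl * x)%R by exact: le_lt_trans mx.
by rewrite -!mulrA ltr_pM2r ?mulr_gt0// ltr_nat.
Qed.

Lemma grid_cover x : (0 < x)%R -> exists n, grid dl n x.
Proof.
move=> x0; have dx0 : (0 < dl * x)%R by rewrite mulr_gt0.
exists (Num.truncn (dl * x)^-1); split => //.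
have /Num.Theory.truncn_itv/andP[] : (0 <= (dl * x)^-1)%R by rewrite invr_ge0 ltW.
by rewrite -2!mulrA -ler_pdivlMr// -ltr_pdivrMr// !div1r.
Qed.

Lemma integral_grid n :
  \int[lebesgue_measure]_(z in grid dl n) (z ^- 2)%:E = dl%:E.
Proof.
have k0 m : (0 < m.+1%:R * dl)%R by rewrite mulr_gt0.
have kE m : \int[lebesgue_measure]_(z in `]((m.+1%:R * dl)^-1)%R, +oo[) (z ^- 2)%:E
    = (m.+1%:R * dl)%:E.
  by rewrite integral_invsqr_tail ?invr_gt0// invrK.
have := kE n; case: n => [|n].
  by rewrite gridE/= setD0 mul1r.
(* The tail beyond 1/((n+2) dl) is the disjoint union of cell n+1 and the tail [B]; the two tails
   have masses (n+2) dl and (n+1) dl. *)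
move=> kn; set B := `]((n.+1%:R * dl)^-1)%R, +oo[%classic.
have gE : `]((n.+2%:R * dl)^-1)%R, +oo[%classic = grid dl n.+1 `|` B.
  rewrite gridE/= -/B setUC setDUK//.
  by apply: subset_itv; rewrite ?bnd_simp// lef_pV2 ?posrE// ler_pM2r// ler_nat.
move: kn; rewrite gE ge0_integral_setU//; last 5 first.
- exact: measurable_grid.
- exact: measurable_itv.
- rewrite -gE; apply/measurable_EFinP; apply: measurable_invsqr => //.
  by apply: subset_itv; rewrite ?bnd_simp// invr_ge0 ltW.
- by move=> x _; rewrite lee_fin invr_ge0 sqr_ge0.
- apply/disj_setPLR => x; rewrite gridE/= => -[_]; exact: contra_not.
(* The mass of the cell is not yet known to be finite, so the cancellation is done in [\bar R]. *)
have aux (x : \bar R) (r t : R) : x + r%:E = t%:E -> x = (t - r)%:E.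
  by case: x => [x||]//= [<-]; rewrite addrK.
rewrite kE => /aux kD; apply: etrans kD _.
by rewrite -mulrBl -natrB// subSnn mul1r.
Qed.
End grid.

(** * Infinite products over points, regrouped by cell *)

Lemma prod_exp_class (R : comNzRingType) (h : nat -> R) (K c : nat) :
  (\prod_(0 <= n < K) h n ^+ (c == n) = if (c < K)%N then h c else 1)%R.
Proof.
case: ifPn => cK.
  rewrite (bigD1_seq c) ?mem_index_iota ?iota_uniq//= eqxx expr1.
  by rewrite big1 ?mulr1// => n nc; rewrite eq_sym (negbTE nc) expr0.
rewrite big_nat big1// => n /= nK; case: eqVneq => // cn.
by move: cK; rewrite cn nK.
Qed.

Lemma prod_by_class (R : comNzRingType) (h : nat -> R) (cl : nat -> nat) (P : pred nat)
  (I K : nat) :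
  (\prod_(0 <= i < I | P i && (cl i < K)%N) h (cl i) =
  \prod_(0 <= n < K) h n ^+ (\sum_(0 <= i < I | P i) (cl i == n)))%R.
Proof.
under [RHS]eq_bigr do rewrite -prodrXr.
rewrite exchange_big/= big_mkcondr/=; apply: eq_bigr => i Pi.
by rewrite prod_exp_class.
Qed.

(** Each sequence is cofinally below the other, so both have the same infimum, which is the limit of
    either. *)
Lemma cvg_interleaved (R : realType) (u v : R^nat) (a : R) :
    nonincreasing_seq u -> nonincreasing_seq v ->
    (forall n, exists k, (v k <= u n)%R) -> (forall k, exists n, (u n <= v k)%R) ->
  u @ \oo --> a -> v @ \oo --> a.
Proof.
move=> du dv uv vu ua; apply/cvgrPdist_le => e e0.
have au n : (a <= u n)%R.
  by rewrite -(cvg_lim (@Rhausdorff R) ua); apply: nonincreasing_cvgn_ge => //; apply/cvg_ex;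
    exists a.
move/cvgrPdist_le : ua => /(_ _ e0)[n _ /(_ n (leqnn n))] une.
have [k vk] := uv n; exists k => // j kj.
have [i vi] := vu j; have vj : (v j <= u n)%R := le_trans (dv _ _ kj) vk.
have avj : (a <= v j)%R := le_trans (au i) vi.
rewrite ler0_norm ?subr_le0// opprB (le_trans _ une)// ler0_norm ?subr_le0// opprB.
by rewrite lerD2r.
Qed.

Lemma prod_nonincreasing (R : realType) (a : R^nat) (P : pred nat) :
  (forall i, 0 <= a i <= 1)%R ->
  nonincreasing_seq (fun I => \prod_(0 <= i < I | P i) a i)%R.
Proof.
move=> a01; apply/nonincreasing_seqP => n; rewrite big_mkcond [leRHS]big_mkcond/=.
rewrite big_nat_recr//= ler_piMr//; last by case: ifP => // _; have /andP[] := a01 n.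
by rewrite prodr_ge0// => i _; case: ifP => // _; have /andP[] := a01 i.
Qed.

(** This rearranges an infinite product of factors in [0, 1]: enumerating the points in order or
    cell by cell gives interleaved nonincreasing sequences. Index [l] is the candidate extremal
    point and is left out, so its own cell loses one factor. *)
Lemma cvg_prod_class (R : realType) (h : nat -> R) (cl N : nat -> nat) (l : nat) (a : R) :
    (forall n, 0 <= h n <= 1)%R ->
    (forall n, \forall I \near \oo, \sum_(0 <= i < I) (cl i == n) = N n)%N ->
    (fun I => \prod_(0 <= i < I | i != l) h (cl i))%R @ \oo --> a ->
  (fun K => \prod_(0 <= n < K) h n ^+ (N n - (n == cl l)))%R @ \oo --> a.
Proof.
move=> h01 clN.
have h0 n : (0 <= h n)%R by have /andP[] := h01 n.
have h1 n : (h n <= 1)%R by have /andP[] := h01 n.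
have clNl K : \forall I \near \oo, forall n, (n < K)%N ->
    (\sum_(0 <= i < I | i != l) (cl i == n) = N n - (n == cl l))%N.
  elim: K => [|K IH]; first by apply: nearW.
  near=> I => n; rewrite ltnS leq_eqVlt => /predU1P[->|]; last first.
    by move: n; near: I.
  have <- : (\sum_(0 <= i < I) (cl i == K) = N K)%N by near: I; exact: clN.
  have lI : (l < I)%N by near: I; exact: nbhs_infty_gt.
  rewrite [in RHS](bigD1_seq l) ?mem_index_iota ?iota_uniq//=.
  by rewrite (eq_sym K) addKn.
have gE K : \forall I \near \oo,
    (\prod_(0 <= n < K) h n ^+ (N n - (n == cl l)) =
     \prod_(0 <= i < I | (i != l) && (cl i < K)%N) h (cl i))%R.
  near=> I; rewrite prod_by_class; apply: eq_big_nat => n nK; congr (_ ^+ _)%R.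
  by apply/esym; move: n nK; near: I; exact: clNl.
apply: cvg_interleaved.
- exact: prod_nonincreasing.
- apply: prod_nonincreasing => n; rewrite exprn_ge0//= exprn_ile1//.
(* [K] exceeds the cells of the first [I] points, so the product over [K] cells contains all their
   factors. *)
- move=> I; pose K := (\max_(0 <= i < I) cl i).+1; exists K.
  near \oo => J.
  have -> : (\prod_(0 <= n < K) h n ^+ (N n - (n == cl l)) =
     \prod_(0 <= i < J | (i != l) && (cl i < K)%N) h (cl i))%R.
    by near: J; exact: gE.
  have IJ : (I <= J)%N by near: J; exact: nbhs_infty_ge.
  rewrite (le_trans (prod_nonincreasing _ _ IJ))// le_eqVlt; apply/orP; left; apply/eqP.
  rewrite big_mkcond [RHS]big_mkcond; apply: eq_big_nat => i iI.
  by rewrite ltnS (@leq_bigmax_seq _ _ xpredT cl) ?andbT ?mem_index_iota.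
(* Conversely, finitely many points exhaust the first [K] cells; the factors of points in further
   cells only decrease the product. *)
- move=> K; near \oo => J; exists J.
  have -> : (\prod_(0 <= n < K) h n ^+ (N n - (n == cl l)) =
     \prod_(0 <= i < J | (i != l) && (cl i < K)%N) h (cl i))%R.
    by near: J; exact: gE.
  rewrite big_mkcond [leRHS]big_mkcond; apply: ler_prod => i _; case: ifPn => //= _.
    by rewrite h0/=; case: ifPn.
  by rewrite ler01 lexx.
Unshelve. all: by end_near. Qed.

(** * Nonnegative series and Poisson generating functions *)

Lemma nneseriesZl_ge0 (R : realType) (f : nat -> \bar R) (x : \bar R) :
  0 <= x -> (forall i, 0 <= f i) ->
  \sum_(i <oo) (x * f i) = x * \sum_(i <oo) f i.
Proof.
move=> + f0; case: x => [x _||]//; first by rewrite nneseriesZl.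
(* For an infinite factor, either all terms vanish or a single positive term makes both sides
   infinite. *)
have [f00|/existsNP[i /eqP fi0] _] := pselect (forall i, f i = 0).
  by rewrite !eseries0 ?mule0// => i _ _; rewrite f00 mule0.
have fi : 0 < f i by rewrite lt_def fi0 f0.
rewrite (@eseries_pinfty _ _ xpredT i)//; last first.
- by rewrite gt0_mulye.
- by move=> n _; rewrite gt_eqF// (lt_le_trans (ltNyr 0%R))// mule_ge0// leey.
rewrite gt0_mulye// (lt_le_trans fi)//.
apply: le_trans (nneseries_lim_ge i.+1 (fun n _ _ => f0 n)).
by rewrite big_nat_recr//= leeDr// sume_ge0.
Qed.

Lemma nneseries_exp (R : realType) (x : R) : (0 <= x)%R ->
  \sum_(c <oo) (x ^+ c / c`!%:R)%:E = (expR x)%:E.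
Proof.
move=> x0; rewrite expRE -EFin_lim; last first.
  rewrite /pseries/=; under eq_fun do rewrite mulrC.
  exact: is_cvg_series_exp_coeff.
apply/congr_lim/funext => n/=; rewrite /pseries/= /series/= -sumEFin//.
by under eq_bigr do rewrite mulrC.
Qed.

Section poisson_generating_function.
Context (R : realType) (dl h : R).
Hypotheses (dl0 : (0 < dl)%R) (h0 : (0 <= h)%R).

Let exp_part : (expR (- (dl * (1 - h))) = expR (- dl) * expR (h * dl))%R.
Proof. by rewrite -expRD; congr expR; rewrite mulrBr mulr1 opprB addrC mulrC. Qed.

Lemma poisson_pgf :
  \sum_(c <oo) (h ^+ c)%:E * (poisson_pmf dl c)%:E = (expR (- (dl * (1 - h))))%:E.
Proof.
have hd0 : (0 <= h * dl)%R by rewrite mulr_ge0// ltW.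
rewrite exp_part EFinM -(nneseries_exp hd0) -nneseriesZl//; last first.
  by move=> c _; rewrite lee_fin divr_ge0// exprn_ge0.
apply: eq_eseriesr => c _; rewrite /poisson_pmf dl0 -!EFinM; congr EFin.
by rewrite exprMn; ring.
Qed.

Lemma poisson_pgf_deriv :
  \sum_(c <oo) (c%:R * h ^+ c.-1)%:E * (poisson_pmf dl c)%:E =
  (dl * expR (- (dl * (1 - h))))%:E.
Proof.
have hd0 : (0 <= h * dl)%R by rewrite mulr_ge0// ltW.
have p0 c : 0 <= (c%:R * h ^+ c.-1)%:E * (poisson_pmf dl c)%:E.
  by rewrite mule_ge0// lee_fin ?poisson_pmf_ge0// mulr_ge0// exprn_ge0.
rewrite nneseries_recl// mul0r mul0e add0e -nneseries_addn//.
rewrite exp_part mulrA EFinM -(nneseries_exp hd0) -nneseriesZl//; last first.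
  by move=> c _; rewrite lee_fin divr_ge0// exprn_ge0.
apply: eq_eseriesr => c _; rewrite /poisson_pmf dl0 -!EFinM addn1; congr EFin.
rewrite factS natrM invfM/= exprMn exprS.
have c0 : (c.+1%:R != 0 :> R)%R by rewrite pnatr_eq0.
by move: c.+1%:R%R c0 (c`!%:R^-1)%R => u u0 v; field.
Qed.

End poisson_generating_function.

(** * Expectation of a product of independent discrete variables *)

Section expectation_product.
Context (R : realType) d (T : measurableType d) (P : probability T R).
Context (I : choiceType) (F : I -> set (set T)) (D : I -> nat -> set T) (f : I -> nat -> R).
Hypotheses (indepF : mutually_independent P F) (FD : forall i c, F i (D i c))
  (mF : forall i, F i `<=` measurable) (f0 : forall i c, (0 <= f i c)%R).

Let X i w : \bar R := \sum_(c <oo) (f i c)%:E * (\1_(D i c) w)%:E.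

Let X0 i w : 0 <= X i w.
Proof. by apply: nneseries_ge0 => c _ _; rewrite mule_ge0// lee_fin. Qed.

Let mX i : measurable_fun setT (X i).
Proof.
apply: ge0_emeasurable_sum => [c w _ _|c _]; first by rewrite mule_ge0// lee_fin.
apply/measurable_funeM/measurable_EFinP; apply: measurable_indic; exact/mF/FD.
Qed.

Let mprodX (r : seq I) : measurable_fun setT (fun w => \prod_(i <- r) X i w).
Proof.
elim: r => [|i r IH].
  by under eq_fun do rewrite big_nil; exact: measurable_cst.
by under eq_fun do rewrite big_cons; exact: emeasurable_funM.
Qed.

(** The indicator of events with indices off [r] strengthens the induction: expanding the head
    factor [X i] over its values moves [i] from [r] to [J], with event [D i c]. Once [r] is empty
    only the independence of events is left. *)
Let expectation_prod_indic (r : seq I) (J : {fset I}) (E : I -> set T) :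
    uniq r -> (forall i, i \in r -> i \notin J) -> (forall i, i \in J -> F i (E i)) ->
  \int[P]_w ((\prod_(i <- r) X i w) * (\1_(\bigcap_(i in [set` J]) E i) w)%:E) =
  (\prod_(i <- r) \sum_(c <oo) (f i c)%:E * P (D i c)) * \prod_(i <- J) P (E i).
Proof.
elim: r J E => [|i r IH] J E /=.
  move=> _ _ FE; rewrite big_nil mul1e.
  under eq_integral do rewrite big_nil mul1e.
  rewrite integral_indic// ?setIT; first exact: indepF.
  by apply: fin_bigcap_measurable => // i iJ; exact/mF/FE.
move=> /andP[ir ur] rJ FE.
have iJ : i \notin J by rewrite rJ// mem_head.
pose E' c j := if j == i then D i c else E j.
have FE' c j : j \in (i |` J)%fset -> F j (E' c j).
  rewrite !inE /E'; case: eqVneq => [->|ji]//=; exact: FE.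
have PE' c : \prod_(j <- (i |` J)%fset) P (E' c j) = P (D i c) * \prod_(j <- J) P (E j).
  rewrite (big_fsetD1 i) ?fset1U1//= {1}/E' eqxx; congr *%E.
  rewrite fsetU1K//; rewrite big_seq [RHS]big_seq; apply: eq_bigr => j jJ.
  by rewrite /E'; case: eqVneq => // ji; move: iJ; rewrite -ji jJ.
have mcap c : measurable (\bigcap_(j in [set` (i |` J)%fset]) E' c j).
  by apply: fin_bigcap_measurable => // j jJ; exact/mF/FE'.
have step c : \int[P]_w ((\prod_(j <- r) X j w) *
    (\1_(\bigcap_(j in [set` (i |` J)%fset]) E' c j) w)%:E) =
    (\prod_(j <- r) \sum_(c <oo) (f j c)%:E * P (D j c)) *
    (P (D i c) * \prod_(j <- J) P (E j)).
  rewrite (IH _ (E' c) ur _ (FE' c)) ?PE'// => j jr.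
  rewrite !inE negb_or rJ ?inE ?jr ?orbT// andbT.
  by apply: contraNneq ir => <-.
have W0 c w : 0 <= (\prod_(j <- r) X j w) *
    (\1_(\bigcap_(j in [set` (i |` J)%fset]) E' c j) w)%:E.
  by rewrite mule_ge0 ?lee_fin// prode_ge0.
transitivity (\int[P]_w \sum_(c <oo) (f i c)%:E * ((\prod_(j <- r) X j w) *
    (\1_(\bigcap_(j in [set` (i |` J)%fset]) E' c j) w)%:E)).
  apply: eq_integral => w _.
  rewrite big_cons -muleA muleC -nneseriesZl_ge0; last 2 first.
  - by rewrite mule_ge0 ?lee_fin// prode_ge0.
  - by move=> c; rewrite mule_ge0 ?lee_fin.
  apply: eq_eseriesr => c _; rewrite muleCA -muleA; congr (_ * (_ * _)).
  rewrite -EFinM; congr EFin; rewrite !indicE -natrM mulnb -in_setI.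
  congr (nat_of_bool _)%:R; congr (_ \in _).
  apply/seteqP; split => [v [EJ Di] j /=|v Ev].
    rewrite !inE /E'; case: eqVneq => [//|ji]/=; exact: EJ.
  split => [j jJ|]; last by have := Ev i; rewrite /= !inE eqxx /E' eqxx; exact.
  have := Ev j; rewrite /= !inE /E' jJ orbT => /(_ isT); case: eqVneq => // ji.
  by move: iJ; rewrite -ji jJ.
rewrite integral_nneseries//; last 2 first.
- move=> c; apply/measurable_funeM/emeasurable_funM; first exact: mprodX.
  by apply/measurable_EFinP; exact: measurable_indic.
- by move=> c w _; rewrite mule_ge0// lee_fin.
rewrite big_cons -muleA muleC -nneseriesZl_ge0; last 2 first.
- rewrite mule_ge0// prode_ge0// => j _; apply: nneseries_ge0 => c _ _.
  by rewrite mule_ge0 ?lee_fin.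
- by move=> c; rewrite mule_ge0 ?lee_fin.
apply: eq_eseriesr => c _; rewrite ge0_integralZl_EFin//; last first.
  apply/emeasurable_funM; first exact: mprodX.
  by apply/measurable_EFinP; exact: measurable_indic.
by rewrite step [RHS]muleCA -[in RHS]muleA (muleC (P (D i c))).
Qed.

Lemma expectation_indep_prod (r : seq I) : uniq r ->
  \int[P]_w (\prod_(i <- r) X i w) =
  \prod_(i <- r) \sum_(c <oo) (f i c)%:E * P (D i c).
Proof.
move=> ur; have := @expectation_prod_indic r fset0 (fun=> setT) ur.
rewrite big_seq_fset0 mule1 => <- //.
apply: eq_integral => w _; rewrite (_ : \bigcap_(_ in _) _ = setT) ?indicT ?mule1//.
by rewrite -subTset => v _ i.
Qed.

End expectation_product.

(** * Counts of Poisson points in the cells of the grid *)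

Lemma nneseries_count (R : realType) (u : nat -> bool) :
  \sum_(i <oo) (u i)%:R%:E != +oo :> \bar R ->
  exists n : nat, \sum_(i <oo) (u i)%:R%:E = n%:R%:E :> \bar R /\
    \forall I \near \oo, (\sum_(0 <= i < I) u i = n)%N.
Proof.
move=> uoo; pose c I := (\sum_(0 <= i < I) u i)%N.
have cE I : \sum_(0 <= i < I) (u i)%:R%:E = (c I)%:R%:E :> \bar R.
  by rewrite sumEFin -natr_sum.
have cu I : (c I)%:R%:E <= \sum_(i <oo) (u i)%:R%:E :> \bar R.
  by rewrite -cE; apply: nneseries_lim_ge => n _ _; rewrite lee_fin.
have u0 : 0 <= \sum_(i <oo) (u i)%:R%:E :> \bar R.
  by apply: nneseries_ge0 => n _ _; rewrite lee_fin.
have [M cM] : exists M, forall I, (c I <= M)%N.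
  move: uoo u0 cu; case: (\sum_(i <oo) _) => [r||]// _ r0 cu.
  exists (Num.truncn r) => I; have := cu I; rewrite lee_fin => cr.
  by rewrite Num.Theory.truncn_ge_nat.
have ndc I J : (I <= J)%N -> (c I <= c J)%N.
  by move=> IJ; rewrite /c (@big_cat_nat _ _ _ I 0 J)//= leq_addr.
have exP : exists n, (fun n => `[< exists I, c I = n >]) n by exists (c 0%N); apply/asboolP;
  exists 0%N.
have leM n : `[< exists I, c I = n >] -> (n <= M)%N by move=> /asboolP[J <-].
(* The partial sums are nondecreasing bounded natural numbers, so they attain a largest value and
   keep it. *)
case: (ex_maxnP exP leM) => n /asboolP[I0 cI0] nmax; exists n.
have cn I : (I0 <= I)%N -> c I = n.
  move=> I0I; apply/eqP; rewrite eqn_leq -{2}cI0 ndc// andbT.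
  by apply: nmax; apply/asboolP; exists I.
split; last by exists I0 => // I /cn.
apply/cvg_lim => //; apply: cvg_near_cst; exists I0 => // I /= /cn cIn.
by rewrite cE cIn.
Qed.

Lemma EFin_natr_inj (R : realType) (i j : nat) : i%:R%:E = j%:R%:E :> \bar R -> i = j.
Proof. by case=> /eqP; rewrite eqr_nat => /eqP. Qed.

Section poisson_grid.
Context (R : realType) d (T : measurableType d) (P : probability T R).
Context (zeta : nat -> T -> R) (dl : R).
Hypotheses (zetaP : poisson_process P `]0%R, +oo[ (fun z => z ^- 2)%R zeta) (dl0 : (0 < dl)%R).

Let N n w := point_count zeta (grid dl n) w.
Let cl i w := Num.truncn (dl * zeta i w)^-1.

Lemma zeta_gt0 i w : (0 < zeta i w)%R.
Proof. by case: zetaP => _ /(_ i w); rewrite /= in_itv/= andbT. Qed.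

Lemma grid_cell n i w : grid dl n (zeta i w) <-> cl i w = n.
Proof.
have [m gm] := grid_cover dl0 (zeta_gt0 i w).
have clm : cl i w = m.
  move: (gm) => [z0 [mz zm]]; apply/eqP; have dz0 : (0 < dl * zeta i w)%R by rewrite mulr_gt0.
  rewrite Num.Theory.truncn_eq ?invr_ge0 ?(ltW dz0)//.
  by rewrite -div1r ler_pdivlMr// ltr_pdivrMr// !mulrA mz.
by split=> [gn|<-]; [rewrite clm; exact: grid_uniq gm gn|rewrite clm].
Qed.

Lemma measurable_grid_zeta n i : <<s \bigcup_(i in setT) preimage_set_system setT
  (zeta i) measurable >>
   [set w | grid dl n (zeta i w)].
Proof.
apply: sub_sigma_algebra; exists i => //; exists (grid dl n); first exact: measurable_grid.
by rewrite setTI.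
Qed.

Lemma cell_count n w : N n w = \sum_(i <oo) (cl i w == n)%:R%:E.
Proof.
apply: eq_eseriesr => i _; rewrite diracE; congr (nat_of_bool _)%:R%:E.
by apply/idP/eqP => [/set_mem/grid_cell|/grid_cell/mem_set].
Qed.

Lemma cell_count_nat n w : N n w != +oo ->
  exists c, N n w = c%:R%:E /\ \forall I \near \oo, (\sum_(0 <= i < I) (cl i w == n) = c)%N.
Proof. by rewrite cell_count; exact: nneseries_count. Qed.

Lemma prob_cell_count n c : P [set w | N n w = c%:R%:E] = (poisson_pmf dl c)%:E.
Proof.
case: zetaP => _ _ /(_ (grid dl n)) + _.
rewrite integral_grid//= => /(_ (measurable_grid dl0 n) (@sub_grid _ dl n) c) ->//.
by rewrite /poisson_prob dl0 esum_set1// lee_fin poisson_pmf_ge0.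
Qed.

Lemma measurable_cell_count n : measurable_fun setT (N n).
Proof.
case: zetaP => mz _ _ _; apply: ge0_emeasurable_sum => //.
move=> i _; apply/measurable_EFinP.
by apply: measurableT_comp (measurable_indic _) (mz i); exact: measurable_grid.
Qed.

Lemma cell_count_finite : {ae P, forall w, forall n, N n w != +oo}.
Proof.
apply/ae_foralln => n.
have mNc (x : \bar R) : measurable [set w | N n w = x].
  by have := measurable_cell_count n measurableT (emeasurable_set1 x); rewrite setTI.
exists [set w | N n w = +oo]; split => //; last by move=> w /=; move/negP; rewrite negbK => /eqP.
have NU : [set w | N n w != +oo] = \bigcup_c [set w | N n w = c%:R%:E].
  apply/seteqP; split => w /=; last by move=> [c _ /= ->].
  by move=> /cell_count_nat[c [Nc _]]; exists c.
have PN1 : P [set w | N n w != +oo] = 1.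
  rewrite NU measure_bigcup//=; last first.
    by move=> i j _ _ [w /= [-> /EFin_natr_inj]].
  under eq_eseriesr do rewrite prob_cell_count.
  (* The generating function at h = 1 says that the Poisson masses of the finite values sum to 1. *)
  have := poisson_pgf dl0 (@ler01 R); rewrite subrr mulr0 oppr0 expR0 => <-.
  rewrite (@eq_eseriesl _ _ xpredT) => [|i]; last by rewrite in_setT.
  by apply: eq_eseriesr => c _; rewrite expr1n mul1e.
have -> : [set w | N n w = +oo] = ~` [set w | N n w != +oo].
  by apply/seteqP; split => w /=; [move=> ->; rewrite eqxx|move/negP; rewrite negbK => /eqP].
have mN : measurable [set w | N n w != +oo] by rewrite NU; exact: bigcup_measurable.
by apply: etrans (probability_setC P mN) _; rewrite PN1 subee.
Qed.

Let measurable_cell_count_eq n c : measurable [set w | N n w = c%:R%:E].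
Proof. by have := measurable_cell_count n measurableT (emeasurable_set1 c%:R%:E);
  rewrite setTI. Qed.

Section moments.
Context (h : nat -> R) (m : nat).
Hypothesis h01 : forall n, (0 <= h n <= 1)%R.

(** In cell [m] one of the c points is chosen as the extremal one and the other c - 1 must pass the
    comparison; in every other cell all c points must pass it. *)
Let f n (c : nat) : R := (if n == m then c%:R * h n ^+ c.-1 else h n ^+ c)%R.
(* f n (N n w), and 0 where N n w = +oo. *)
Let X n w : \bar R := \sum_(c <oo) (f n c)%:E * (\1_[set w | N n w = c%:R%:E] w)%:E.

Let h0 n : (0 <= h n)%R. Proof. by have /andP[] := h01 n. Qed.

Let f0 n c : (0 <= f n c)%R.
Proof. by rewrite /f; case: ifP => _; rewrite ?mulr_ge0// exprn_ge0. Qed.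

Let indic_seriesE (g : nat -> R) n w c : (forall c, (0 <= g c)%R) -> N n w = c%:R%:E ->
  \sum_(c <oo) (g c)%:E * (\1_[set w | N n w = c%:R%:E] w)%:E = (g c)%:E.
Proof.
move=> g0 Nc; rewrite (@nneseriesD1 _ _ c)//; last by move=> ? _; rewrite mule_ge0 ?lee_fin.
rewrite indicE mem_set//= mule1 eseries0 ?adde0// => i _ /= ic.
rewrite indicE memNset ?mule0//= Nc => /EFin_natr_inj ci.
by rewrite ci eqxx in ic.
Qed.

Let XE n w c : N n w = c%:R%:E -> X n w = (f n c)%:E.
Proof. by move=> Nc; rewrite /X (indic_seriesE _ Nc). Qed.

Let X0 n w : 0 <= X n w.
Proof. by apply: nneseries_ge0 => c _ _; rewrite mule_ge0// lee_fin. Qed.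

Let mX n : measurable_fun setT (X n).
Proof.
apply: ge0_emeasurable_sum => [c w _ _|c _]; first by rewrite mule_ge0// lee_fin.
apply/measurable_funeM/measurable_EFinP; exact: measurable_indic.
Qed.

Let mprodX (K : nat) : measurable_fun setT (fun w => \prod_(n < K) X n w).
Proof.
elim: K => [|K IH].
  by under eq_fun do rewrite big_ord0; exact: measurable_cst.
by under eq_fun do rewrite big_ord_recr/=; exact: emeasurable_funM.
Qed.

Let integral_prodX (K : nat) : (m < K)%N ->
  \int[P]_w (\prod_(n < K) X n w) =
  (dl * expR (- \sum_(0 <= n < K) dl * (1 - h n)))%:E.
Proof.
move=> mK; case: zetaP => _ _ _ /(_ K (fun i => grid dl i)) indepN.
pose F (i : 'I_K) := sigma_gen setT (fun _ : unit => N i).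
have FD (i : 'I_K) c : F i [set w | N i w = c%:R%:E].
  apply: sub_sigma_algebra; exists tt => //; exists [set c%:R%:E]; first exact: emeasurable_set1.
  by rewrite setTI.
have mF (i : 'I_K) : F i `<=` measurable.
  apply: smallest_sub; first exact: sigma_algebra_measurable.
  by move=> _ [_ _ [B mB <-]]; exact: measurable_cell_count.
have indepF : mutually_independent P F.
  apply: indepN.
  - by move=> i; exact: measurable_grid.
  - by move=> i; exact: sub_grid.
  - move=> i j _ _ [x [gi gj]]; apply/val_inj; exact: grid_uniq gi gj.
rewrite (expectation_indep_prod indepF FD mF (fun i => f0 i) (index_enum_uniq _)).
transitivity (\prod_(n < K) ((if n == m :> nat then dl else 1) * expR (- (dl * (1 - h n))))%:E).
  apply: eq_bigr => i _; under eq_eseriesr do rewrite prob_cell_count.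
  rewrite /f; case: eqVneq => _; first exact: poisson_pgf_deriv.
  by rewrite mul1r; exact: poisson_pgf.
rewrite prodEFin; congr EFin; rewrite big_split/=; congr (_ * _)%R.
  rewrite (bigD1 (Ordinal mK))//= eqxx big1 ?mulr1// => i im.
  by rewrite ifN//; apply: contraNneq im => im; apply/eqP/val_inj.
by rewrite -expR_sum -sumrN big_mkord.
Qed.

(** Almost surely the count of cell [m]: the integrable dominating function, of mean [dl]. *)
Let Y w := \sum_(c <oo) (c%:R)%:E * (\1_[set w | N m w = c%:R%:E] w)%:E : \bar R.

Let Y0 w : 0 <= Y w.
Proof. by apply: nneseries_ge0 => c _ _; rewrite mule_ge0// lee_fin. Qed.

Let mY : measurable_fun setT Y.
Proof.
apply: ge0_emeasurable_sum => [c w _ _|c _]; first by rewrite mule_ge0// lee_fin.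
apply/measurable_funeM/measurable_EFinP; exact: measurable_indic.
Qed.

Let integral_Y : \int[P]_w Y w = dl%:E.
Proof.
rewrite integral_nneseries//; last first.
  by move=> c; apply/measurable_funeM/measurable_EFinP; exact: measurable_indic.
have := poisson_pgf_deriv dl0 (@ler01 R); rewrite subrr mulr0 oppr0 expR0 mulr1 => <-.
apply: eq_eseriesr => c _; rewrite ge0_integralZl_EFin//; last first.
  by apply/measurable_EFinP; exact: measurable_indic.
by rewrite integral_indic// setIT [X in _ * X]prob_cell_count expr1n mulr1.
Qed.

(** Here [a l] is meant to be the conditional probability, given the points, that the l-th one lies
    in cell [m] and all others pass the comparison. Summed over [l], it is almost surely N_m
    h_m^(N_m - 1) times the product of the h_n^(N_n), n <> m. Truncating this to finitely many cells
    gives products of independent factors, with expectations known from the generating functions,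
    and dominated convergence passes to the limit. *)
Lemma poisson_sum_cvg (a : nat -> T -> R) :
    (forall l, measurable_fun setT (a l)) -> (forall l w, (0 <= a l w)%R) ->
    (forall l w, cl l w != m -> a l w = 0%R) ->
    (forall l w, cl l w = m ->
      (fun I => \prod_(0 <= i < I | i != l) h (cl i w))%R @ \oo --> a l w) ->
  (fun K => (dl * expR (- \sum_(0 <= n < K) dl * (1 - h n)))%:E) @ \oo -->
    \sum_(l <oo) \int[P]_w (a l w)%:E.
Proof.
move=> ma a0 anm am.
have ma' l : measurable_fun setT (EFin \o a l) by apply/measurable_EFinP.
rewrite -integral_nneseries//; last by move=> l w _; rewrite lee_fin.
(* Taking at least m + 1 cells ensures that the special factor of cell [m] is always present. *)
pose u K w := \prod_(n < (K + m.+1)%N) X n w.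
have uE w (Nn : nat -> nat) : (forall n, N n w = (Nn n)%:R%:E) -> forall K, u K w =
    ((Nn m)%:R * \prod_(0 <= n < (K + m.+1)%N) h n ^+ (Nn n - (n == m)))%:E.
  move=> NNn K; transitivity (\prod_(n < K + m.+1) (f n (Nn n))%:E).
    by apply: eq_bigr => n _; exact: XE.
  rewrite prodEFin; congr EFin; rewrite big_mkord.
  have mK : (m < K + m.+1)%N by rewrite addnS ltnS leq_addl.
  rewrite (bigD1 (Ordinal mK))//= [in RHS](bigD1 (Ordinal mK))//= /f eqxx subn1 mulrA;
    congr (_ * _)%R.
  apply: eq_bigr => i im; rewrite (_ : i == m :> nat = false) ?subn0//.
  by apply/negbTE; apply: contraNneq im => im; apply/eqP/val_inj.
have /choice[Nn NE] w : exists Nn : nat -> nat, (forall n, N n w != +oo) ->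
    forall n, N n w = (Nn n)%:R%:E /\
    \forall I \near \oo, (\sum_(0 <= i < I) (cl i w == n) = Nn n)%N.
  have [/(_ _)/cell_count_nat/cid-/all_sig[Nn NE]|] := pselect (forall n, N n w != +oo).
    by exists Nn.
  by exists (fun=> 0%N).
have aeN : {ae P, forall w, forall n, N n w = (Nn w n)%:R%:E /\
    \forall I \near \oo, (\sum_(0 <= i < I) (cl i w == n) = Nn w n)%N}.
  by apply: filterS cell_count_finite => w /NE.
have [] := @dominated_convergence _ _ _ P setT measurableT
  u (fun w => \sum_(l <oo) (a l w)%:E) Y.
- by move=> K; exact: mprodX.
- by apply: ge0_emeasurable_sum => [l w _ _|l _]; [rewrite lee_fin|exact: ma'].
- apply: filterS aeN => w {}NE _.
  have NnE n : N n w = (Nn w n)%:R%:E by have [] := NE n.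
  under eq_fun do rewrite (uE w (Nn w) NnE).
  have clN n : \forall I \near \oo, (\sum_(0 <= i < I) (cl i w == n) = Nn w n)%N by have [] :=
    NE n.
  have agE l : cl l w = m -> (fun K => \prod_(0 <= n < K) h n ^+ (Nn w n - (n == m)))%R @ \oo -->
    a l w.
    by move=> clm; rewrite -clm; apply: (cvg_prod_class h01 clN); exact: am.
  (* If cell [m] is empty, both sides vanish. Otherwise its N_m points all have the same [a l w],
     because removing any one of them leaves the same cell counts. *)
  have [[l0 cl0]|nocl] := pselect (exists l, cl l w = m); last first.
    have Nm0 : (Nn w m)%:R = 0%R :> R.
      apply: EFin_inj; rewrite -NnE cell_count; apply: eseries0 => i _ _.
      by case: eqVneq => // clm; case: nocl; exists i.
    rewrite eseries0 => [|l _ _]; last first.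
      by rewrite anm//; apply/eqP => clm; apply: nocl; exists l.
    by under eq_fun do rewrite Nm0 mul0r; exact: cvg_cst.
  have -> : \sum_(l <oo) (a l w)%:E = ((Nn w m)%:R * a l0 w)%:E.
    rewrite mulrC EFinM -NnE cell_count -nneseriesZl//.
    apply: eq_eseriesr => l _; case: eqVneq => clm; last by rewrite anm ?mule0.
    by rewrite mule1; congr EFin; apply: cvg_unique (agE _ clm) (agE _ cl0).
  apply: cvg_EFin; first exact: nearW.
  apply: cvgMr; have := agE _ cl0.
  by rewrite -(cvg_shiftn m.+1).
- by apply/integrableP; split => //; under eq_integral do rewrite gee0_abs//;
  rewrite integral_Y ltry.
(* Domination: apart from the count of cell [m], every factor lies in [0, 1]. *)
- apply: filterS aeN => w {}NE K _.
  have NnE n : N n w = (Nn w n)%:R%:E by have [] := NE n.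
  rewrite (uE w (Nn w) NnE) /Y (indic_seriesE _ (NnE m))// lee_fin.
  rewrite ger0_norm ?mulr_ge0 ?prodr_ge0// => [|i _]; last exact: exprn_ge0.
  rewrite ler_piMr// prodr_ile1// => i _; rewrite exprn_ge0//= exprn_ile1//.
  by have /andP[] := h01 i.
move=> _ _ cv; rewrite -(cvg_shiftn m.+1).
have mK K : (m < K + m.+1)%N by rewrite addnS ltnS leq_addl.
by under eq_fun do rewrite -(integral_prodX (mK _)).
Qed.

End moments.
End poisson_grid.

(** * Measurability of events built from implications and quantifiers *)

Lemma measurable_imply d (T : measurableType d) (A B : set T) :
  measurable A -> measurable B -> measurable [set x | A x -> B x].
Proof.
move=> mA mB; rewrite (_ : [set x | _] = ~` A `|` B); last first.
  apply/seteqP; split => x /=; last by case.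
  by have [Ax AB|nAx _] := pselect (A x); [right; exact: AB|left].
by apply: measurableU => //; exact: measurableC.
Qed.

Lemma measurable_imply_prop d (T : measurableType d) (Q : Prop) (A : set T) :
  (Q -> measurable A) -> measurable [set x | Q -> A x].
Proof.
have [q /(_ q) mA|nq _] := pselect Q.
  by rewrite (_ : [set x | _] = A)//; apply/seteqP; split => x //=; exact.
rewrite (_ : [set x | _] = setT)//; apply/seteqP; split => // x _ q; by case: (nq q).
Qed.

Lemma measurable_forall d (T : measurableType d) (A : nat -> set T) :
  (forall i, measurable (A i)) -> measurable [set x | forall i, A i x].
Proof.
move=> mA; rewrite (_ : [set x | _] = \bigcap_i A i); first exact: bigcapT_measurable.
by apply/seteqP; split => [x Ax i _|x Ax i]; [exact: Ax|exact: (Ax i I)].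
Qed.

Lemma measurable_forall_ord d (T : measurableType d) k (A : 'I_k -> set T) :
  (forall i, measurable (A i)) -> measurable [set x | forall i, A i x].
Proof.
move=> mA; rewrite (_ : [set x | _] = \bigcap_i A i).
  by apply: fin_bigcap_measurable => //; exact: finite_finset.
by apply/seteqP; split => [x Ax i _|x Ax i]; [exact: Ax|exact: (Ax i I)].
Qed.

Lemma measurable_fun_sub_sigma d (T : measurableType d) (G : set (set T)) :
  G `<=` measurable -> measurable_fun setT (id : T -> g_sigma_algebraType G).
Proof.
move=> mG _ B mB; rewrite setTI.
by apply: (smallest_sub (sigma_algebra_measurable T) mG).
Qed.

(** * Poisson points carrying independent marks *)

Section marked_poisson.
Context (R : realType) d (T : measurableType d) (P : probability T R).
Context (zeta : nat -> T -> R) (dl : R) (G : set (set T)) (V : nat -> nat -> set T)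
  (h : nat -> R) (m : nat).
Hypotheses (zetaP : poisson_process P `]0%R, +oo[ (fun z => z ^- 2)%R zeta) (dl0 : (0 < dl)%R).
Hypotheses (mG : G `<=` measurable)
  (zetaG : independent_classes P (sigma_gen setT (fun i w => zeta i w)) <<s G >>)
  (GV : forall i n, <<s G >> (V i n))
  (PV : forall (J : {fset nat}) (c : nat -> nat),
    P (\bigcap_(i in [set` J]) V i (c i)) = (\prod_(i <- J) h (c i))%:E).

Let Gz := \bigcup_(i in setT) preimage_set_system setT (fun w => zeta i w) measurable.
Let cl i w := Num.truncn (dl * zeta i w)^-1.
(** Both coordinates range over the sample space itself, once with the sigma-algebra of the points
    and once with that of the marks, so that decoupling freezes the points and averages over the
    marks. *)
Let E l : set (g_sigma_algebraType Gz * g_sigma_algebraType G) :=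
  [set x | grid dl m (zeta l x.1) /\ forall i n, i != l -> grid dl n (zeta i x.1) -> V i n x.2].

Let mGz : Gz `<=` measurable.
Proof.
move=> _ [i _ [B mB <-]].
by case: zetaP => /(_ i) mz _ _ _; exact: mz.
Qed.

Let mE l : measurable (E l).
Proof.
have mgz n i : measurable (fst @^-1` [set w | grid dl n (zeta i w)] : set
  (g_sigma_algebraType Gz * g_sigma_algebraType G)).
  rewrite -[X in measurable X]setTI; apply: measurable_fst => //; exact: measurable_grid_zeta.
apply: measurableI; first exact: mgz.
apply: measurable_forall => i; apply: measurable_forall => n.
apply: measurable_imply_prop => il.
apply: measurable_imply; first exact: mgz.
rewrite (_ : (fun _ => _) = snd @^-1` (V i n))//.
by rewrite -[X in measurable X]setTI; apply: measurable_snd => //; exact: GV.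
Qed.

Let h01 n : (0 <= h n <= 1)%R.
Proof.
have := PV [fset 0%N]%fset (fun=> n).
rewrite big_seq_fset1 => /esym hE.
rewrite -!lee_fin hE measure_ge0/=; apply: probability_le1.
apply: fin_bigcap_measurable => // i _; exact: (smallest_sub (sigma_algebra_measurable T) mG).
Qed.

(** Given the points, the events [V i n] are tested at n = the cell of point i only, so by [PV] the
    conditional probability is the infinite product required by [poisson_sum_cvg]. *)
Lemma marked_sum_cvg :
  (fun K => (dl * expR (- \sum_(0 <= n < K) dl * (1 - h n)))%:E) @ \oo -->
  \sum_(l <oo) P [set w | grid dl m (zeta l w) /\
    forall i n, i != l -> grid dl n (zeta i w) -> V i n w].
Proof.
pose a l (w : T) : R := fine (P [set w' | E l (w, w')]).
have mid1 := measurable_fun_sub_sigma mGz.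
have mid2 := measurable_fun_sub_sigma mG.
have aE l w : (a l w)%:E = P [set w' | E l (w, w')].
  rewrite fineK// fin_num_measure//.
  have := measurable_xsection (w : g_sigma_algebraType Gz) (mE l); rewrite xsectionE.
  exact: (smallest_sub (sigma_algebra_measurable T) mG).
have ma l : measurable_fun setT (a l).
  apply/measurable_EFinP; rewrite (_ : _ \o _ = fun w => P [set w' | E l (w, w')]).
    have ms := measurable_section_prob P mid2 (mE l).
    exact: (measurableT_comp ms mid1).
  by apply/funext => w; exact: aE.
have PE l : P [set w | grid dl m (zeta l w) /\
    forall i n, i != l -> grid dl n (zeta i w) -> V i n w] = \int[P]_w (a l w)%:E.
  pose X1 : {mfun T >-> g_sigma_algebraType Gz} := HB.pack (id : T -> g_sigma_algebraType Gz)
    (isMeasurableFun.Build _ _ _ _ _ mid1).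
  rewrite [LHS](@prob_decouple _ _ _ _ _ _ _ P (distribution P X1)
    (id : T -> g_sigma_algebraType Gz) (id : T -> g_sigma_algebraType G) mid1 mid2 (E l)) //.
  rewrite ge0_integral_distribution//.
  - by apply: eq_integral => w _; rewrite aE.
  - by have ms := measurable_section_prob P mid2 (mE l); exact: ms.
under eq_eseriesr do rewrite PE.
apply: (@poisson_sum_cvg _ _ _ _ zeta dl zetaP dl0 h m h01 a).
- by [].
- by move=> l w; rewrite fine_ge0.
- move=> l w clm; rewrite /a (_ : [set w' | _] = set0) ?measure0//.
  by apply/seteqP; split => // w' [/(grid_cell zetaP dl0) clE _]; case/eqP: clm.
move=> l w clm.
pose J I := seq_fset tt [seq i <- index_iota 0 I | i != l].
(* With the points frozen at [w], these events for the first [I] points decrease to the section of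
   [E l], and their probabilities are the partial products. *)
pose F I := \bigcap_(i in [set` J I]) V i (cl i w).
have PF I : P (F I) = (\prod_(0 <= i < I | i != l) h (cl i w))%:E.
  rewrite /F (PV (J I) (cl ^~ w)) (perm_big _ (seq_fset_perm _ _))/=.
  by rewrite undup_id ?filter_uniq ?iota_uniq// big_filter.
have mV i n : measurable (V i n) by apply: (smallest_sub (sigma_algebra_measurable T) mG).
have mF I : measurable (F I) by apply: fin_bigcap_measurable => // i _.
have EF : [set w' | E l (w, w')] = \bigcap_I F I.
  apply/seteqP; split => [w' [_ VE] I _ i|w' FE].
    by rewrite /= seq_fsetE mem_filter => /andP[il _]; apply: VE => //;
      apply/(grid_cell zetaP dl0).
  split; first exact/(grid_cell zetaP dl0).
  move=> i n il /(grid_cell zetaP dl0) <-; apply: (FE i.+1) => //.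
  by rewrite /= seq_fsetE mem_filter il mem_index_iota/=.
have : P \o F @ \oo --> P (\bigcap_I F I).
  apply: nonincreasing_cvg_mu => //.
  - by rewrite (le_lt_trans (probability_le1 _ _)) ?ltry.
  - exact: bigcapT_measurable.
  - move=> I I' II'; apply/subsetPset => w' FE i;
    rewrite /= seq_fsetE mem_filter mem_index_iota => /and3P[il _ iI].
    by apply: FE; rewrite /= seq_fsetE mem_filter il mem_index_iota/= (leq_trans iI).
rewrite -EF -aE => /fine_cvgP[_]; apply: cvg_trans; apply: near_eq_cvg; apply: nearW => I.
by rewrite /= PF.
Qed.

End marked_poisson.

(** * Paths as random elements of a product space *)

Section path_space.
Context (R : realType) (dim : nat) (X : set 'rV[R]_dim).

Definition path_gen : set (set ('rV[R]_dim -> R)) :=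
  \bigcup_(s in X) preimage_set_system setT (fun y => y s) measurable.

(** This carries the sigma-algebra used in [same_law], so equality in law becomes equality of
    pushforward measures. *)
Definition path_space := g_sigma_algebraType path_gen.

HB.instance Definition _ := Measurable.on path_space.

Lemma measurable_eval s : X s -> measurable_fun setT (fun y : path_space => y s).
Proof.
move=> Xs _ B mB; rewrite setTI; apply: sub_sigma_algebra; exists s => //.
by exists B => //; rewrite setTI.
Qed.

Lemma measurable_path d (T : measurableType d) (Z : 'rV[R]_dim -> T -> R) :
  (forall s, X s -> measurable_fun setT (Z s)) ->
  measurable_fun setT (fun w => Z ^~ w : path_space).
Proof.
move=> mZ; apply: (@measurability _ _ T path_space _ _ path_gen) => //.
move=> _ [_ [s Xs [B mB <-]] <-].
by rewrite setTI; have := mZ s Xs measurableT B mB; rewrite !setTI.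
Qed.

End path_space.
Arguments path_space {R dim}.

Lemma sub_sigma_gen (T I : Type) d (S : measurableType d) (D : set I) (Z : I -> T -> S) i :
  D i -> forall B, measurable B -> sigma_gen D Z (Z i @^-1` B).
Proof. by move=> Di B mB; apply: sub_sigma_algebra; exists i => //; exists B; rewrite ?setTI. Qed.

Lemma sigma_gen_path (R : realType) (dim : nat) (X : set 'rV[R]_dim)
    d (T : measurableType d) (Z : 'rV[R]_dim -> T -> R) (C : set (path_space X)) :
  measurable C -> sigma_gen X (fun s w => Z s w) [set w | C (Z ^~ w)].
Proof.
move=> mC.
pose G := \bigcup_(s in X) preimage_set_system setT (fun w => Z s w) measurable.
have mZ : measurable_fun setT (fun w : g_sigma_algebraType G => Z ^~ w : path_space X).
  apply: measurable_path => s Xs _ B mB; rewrite setTI.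
  by apply: (@sub_sigma_gen _ _ _ _ X (fun s w => Z s w) s).
by have := mZ measurableT C mC; rewrite setTI.
Qed.

Lemma sub_g_sigma (T : Type) (G H : set (set T)) : G `<=` <<s H >> -> <<s G >> `<=` <<s H >>.
Proof. by move=> GH; apply: smallest_sub => //; exact: smallest_sigma_algebra. Qed.

(** * Separating the path of the l-th point from the points and the other paths *)

Section decoupled_extremal_sum.
Context (R : realType) (dim : nat) (X : set 'rV[R]_dim)
  (dO : measure_display) (Omega : measurableType dO) (P : probability Omega R)
  (zeta : nat -> Omega -> R) (Ys : nat -> 'rV[R]_dim -> Omega -> R)
  (dY : measure_display) (TY : measurableType dY) (Q : probability TY R)
  (Y : 'rV[R]_dim -> TY -> R).
Hypotheses (mY : forall s, X s -> measurable_fun setT (Y s))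
  (eta_repr : spectral_representation X P zeta Ys Q Y).
Context (k : nat) (s : 'I_k -> 'rV[R]_dim) (s_in_X : forall j, X (s j)).
Context (dl : R) (dl0 : (0 < dl)%R) (m : nat) (a : R) (b : nat -> R).

(* The comparison g / f <= b n / a at the s_j, multiplied out so that it also makes
   sense where f or a vanishes. *)
Definition scaled_le n (f g : 'rV[R]_dim -> R) :=
  forall j : 'I_k, (a * g (s j) <= b n * f (s j))%R.

Let zetaP := let: And4 h _ _ _ := eta_repr in h.
Let copies := let: And4 _ h _ _ := eta_repr in h.
Let indepY := let: And4 _ _ h _ := eta_repr in h.
Let indep_zeta := let: And4 _ _ _ h := eta_repr in h.

Let mYs i u : X u -> measurable_fun setT (Ys i u).
Proof. by move=> Xu; have [[h _ _] _] := copies i; exact: h. Qed.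

Let Gz := \bigcup_(i in setT) preimage_set_system setT (fun w => zeta i w) measurable.
Let Gy := \bigcup_(p in setT `*` X) preimage_set_system setT
  (fun w => Ys p.1 p.2 w) measurable.

Let mGz : Gz `<=` measurable.
Proof.
by move=> _ [i _ [B mB <-]]; case: zetaP => /(_ i) mz _ _ _; exact: mz.
Qed.

Let mGy : Gy `<=` measurable.
Proof. by move=> _ [[i u] [_ /= Xu] [B mB <-]]; exact: mYs. Qed.

Let sigma_Ys_sub i : sigma_gen X (fun s w => Ys i s w) `<=` <<s Gy >>.
Proof.
apply: sub_g_sigma => _ [u Xu [B mB <-]].
by apply: sub_sigma_algebra; exists (i, u) => //; exists B.
Qed.

Let law_Ys i (C : set (path_space X)) : measurable C ->
  P [set w | C (Ys i ^~ w)] = Q [set y | C (Y ^~ y)].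
Proof. by move=> mC; have [_] := copies i; apply. Qed.

Lemma measurable_scaled_ler n f : measurable [set g : path_space X | scaled_le n f g].
Proof.
apply: measurable_forall_ord => j.
rewrite -[X in measurable X]setTI; apply: measurable_fun_le => //.
by apply: measurable_funM => //; exact: measurable_eval.
Qed.

(** For a frozen path [f], the comparisons of the [Ys i] with [f] are independent marks, and their
    probabilities depend on the cell only, by equality in law. *)
Lemma section_sum_cvg (f : 'rV[R]_dim -> R) :
  (fun K => (dl * expR (- \sum_(0 <= n < K) dl *
    (1 - fine (Q [set y | scaled_le n f (Y ^~ y)]))))%:E) @ \oo -->
  \sum_(l <oo) P [set w | grid dl m (zeta l w) /\ forall i n, i != l ->
    grid dl n (zeta i w) -> scaled_le n f (Ys i ^~ w)].
Proof.
have VY i n : sigma_gen X (fun s w => Ys i s w) [set w | scaled_le n f (Ys i ^~ w)].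
  by have := sigma_gen_path (Z := Ys i) (measurable_scaled_ler n f).
apply: (@marked_sum_cvg _ _ _ P zeta dl Gy (fun i n => [set w | scaled_le n f (Ys i ^~ w)])) =>
  //.
- by move=> i n; exact: (sigma_Ys_sub (VY i n)).
move=> J c; rewrite (indepY (E := fun i => [set w | scaled_le (c i) f (Ys i ^~ w)])); last first.
  by move=> i _; exact: VY.
rewrite -prodEFin; apply: eq_bigr => i _.
rewrite (law_Ys i (measurable_scaled_ler (c i) f)) fineK// fin_num_measure//.
by have := measurable_path mY measurableT (measurable_scaled_ler (c i) f); rewrite setTI.
Qed.

(* A pi-system generating everything that is independent of Ys l. *)
Let others l : set (set Omega) :=
  [set A | exists (Z : set Omega) (J : {fset nat}) (E : nat -> set Omega),
  [/\ <<s Gz >> Z, l \notin J, forall i, i \in J -> sigma_gen X (fun s w => Ys i s w) (E i) &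
      A = Z `&` \bigcap_(i in [set` J]) E i]].

Let sigma_cap (J : {fset nat}) (E : nat -> set Omega) :
  (forall i, i \in J -> sigma_gen X (fun s w => Ys i s w) (E i)) ->
  <<s Gy >> (\bigcap_(i in [set` J]) E i).
Proof.
move=> JE; apply: (@fin_bigcap_measurable _ (g_sigma_algebraType Gy)) => // i iJ.
exact: (sigma_Ys_sub (JE i iJ)).
Qed.

Let mGz' := smallest_sub (sigma_algebra_measurable Omega) mGz.
Let mGy' := smallest_sub (sigma_algebra_measurable Omega) mGy.

Let m_others l : others l `<=` measurable.
Proof.
move=> _ [Z [J [E [GZ _ JE ->]]]]; apply: measurableI; first exact: mGz'.
by apply: mGy'; exact: sigma_cap.
Qed.

Let cap_fset0 (E : nat -> set Omega) : \bigcap_(i in [set` fset0]) E i = setT.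
Proof. by rewrite -subTset => w _ i. Qed.

Let othersT l : others l setT.
Proof.
exists setT, fset0, (fun=> setT); split => //; last by rewrite cap_fset0 setTI.
exact: (@measurableT _ (g_sigma_algebraType Gz)).
Qed.

Let othersI l : setI_closed (others l).
Proof.
move=> _ _ [Z [J [E [GZ lJ JE ->]]]] [Z' [J' [E' [GZ' lJ' JE' ->]]]].
exists (Z `&` Z'), (J `|` J')%fset,
  (fun i => (if i \in J then E i else setT) `&` (if i \in J' then E' i else setT)).
split.
- exact: (@measurableI _ (g_sigma_algebraType Gz)).
- by rewrite inE negb_or lJ.
- move=> i _; apply: (@measurableI _
  (g_sigma_algebraType (\bigcup_(s in X) preimage_set_system setT
    (fun w => Ys i s w) measurable))).
    case: ifPn => [/JE//|_].
    exact: (@measurableT _ (g_sigma_algebraType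
      (\bigcup_(s in X) preimage_set_system setT (fun w => Ys i s w) measurable))).
  case: ifPn => [/JE'//|_].
  exact: (@measurableT _ (g_sigma_algebraType
    (\bigcup_(s in X) preimage_set_system setT (fun w => Ys i s w) measurable))).
- rewrite setIACA; congr (_ `&` _); apply/seteqP; split => w.
    by move=> [EJ EJ'] i _ /=; split; case: ifPn => //; [exact: EJ|exact: EJ'].
  move=> EE; split => i /= iJ; have := EE i; rewrite /= inE iJ ?orbT => /(_ isT) [] //.
Qed.

(** Since [l] is not in [J], the event on [Ys l] joins the family [E] as one more independent
    member; the event on the points splits off before and after. *)
Let indep_others l (C : set (path_space X)) (A : set Omega) : measurable C -> others l A ->
  P ([set w | C (Ys l ^~ w)] `&` A) = P [set w | C (Ys l ^~ w)] * P A.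
Proof.
move=> mC [Z [J [E [GZ lJ JE ->]]]].
have CY := sigma_gen_path (Z := Ys l) mC.
pose E' i := if i == l then [set w | C (Ys l ^~ w)] else E i.
have JE' i : i \in (l |` J)%fset -> sigma_gen X (fun s w => Ys i s w) (E' i).
  by rewrite !inE /E'; case: eqVneq => [->|il]//=; exact: JE.
have capE : \bigcap_(i in [set` (l |` J)%fset]) E' i =
  [set w | C (Ys l ^~ w)] `&` \bigcap_(i in [set` J]) E i.
  apply/seteqP; split => w.
    move=> EE; split; first by have := EE l; rewrite /= !inE eqxx /E' eqxx; exact.
    move=> i iJ; have := EE i; rewrite /= !inE /E' iJ orbT => /(_ isT).
    by case: eqVneq => // il; move: lJ; rewrite -il iJ.
  by move=> [Cw EJ] i /=; rewrite !inE /E'; case: eqVneq => [//|il]/=; exact: EJ.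
rewrite setICA -capE (indep_zeta GZ (sigma_cap JE')) (indep_zeta GZ (sigma_cap JE)).
rewrite (indepY JE') (indepY JE) (big_fsetD1 l) ?fset1U1//= {1}/E' eqxx.
rewrite fsetU1K// muleCA; congr (_ * (_ * _)); rewrite big_seq [RHS]big_seq;
  apply: eq_bigr => i iJ.
by rewrite /E'; case: eqVneq => // il; move: lJ; rewrite -il iJ.
Qed.

(** The path of the l-th point is a separate argument [f], to be either frozen or replaced by
    [Ys l]; [B] restricts the admissible paths. *)
Definition extremal_event (B : set ('rV[R]_dim -> R)) l (f : 'rV[R]_dim -> R) : set Omega :=
  [set w | [/\ B f, grid dl m (zeta l w) & forall i n, i != l ->
    grid dl n (zeta i w) -> scaled_le n f (Ys i ^~ w)]].

Let extremal_set (B : set (path_space X)) l : set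
  (path_space X * g_sigma_algebraType (others l)) :=
  [set x | extremal_event B l x.1 x.2].

(** The second coordinate enters only through the points and the paths with i <> l, which are
    measurable for the sigma-algebra generated by [others l]. *)
Let m_extremal_set (B : set (path_space X)) l : measurable B -> measurable (@extremal_set B l).
Proof.
move=> mB.
have m2 A : <<s others l >> A -> measurable
  (snd @^-1` A : set (path_space X * g_sigma_algebraType (others l))).
  by move=> oA; rewrite -[X in measurable X]setTI; exact: measurable_snd.
have mgz n i : measurable [set x : path_space X * g_sigma_algebraType (others l) | grid dl n
  (zeta i x.2)].
  apply: (m2 [set w | grid dl n (zeta i w)]); apply: sub_sigma_algebra.
  exists [set w | grid dl n (zeta i w)], fset0, (fun=> setT); split => //.
    exact: measurable_grid_zeta.
  by rewrite cap_fset0 setIT.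
have mYo i u : i != l -> X u -> measurable_fun setT
  (fun x : path_space X * g_sigma_algebraType (others l) => Ys i u x.2).
  move=> il Xu; apply: (@measurableT_comp _ _ _ _ _ _
    (Ys i u : g_sigma_algebraType (others l) -> R)); last exact: measurable_snd.
  move=> _ D mD; rewrite setTI; apply: sub_sigma_algebra.
  exists setT, [fset i]%fset, (fun=> Ys i u @^-1` D); split => //.
  - exact: (@measurableT _ (g_sigma_algebraType Gz)).
  - by rewrite inE eq_sym.
  - move=> j; rewrite inE => /eqP ->.
    by apply: (@sub_sigma_gen _ _ _ _ X (fun s w => Ys i s w) u).
  - rewrite setTI; apply/seteqP; split => [w Dw j //|w]; apply; first by rewrite /= inE.
rewrite (_ : @extremal_set B l = (fst @^-1` B `&` [set x | grid dl m (zeta l x.2)]) `&`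
  [set x | forall i n, i != l -> grid dl n (zeta i x.2) -> scaled_le n x.1 (Ys i ^~ x.2)]);
    last first.
  by apply/seteqP; split => x /= => [[? ? ?]|[[? ?] ?]].
apply: measurableI; first apply: measurableI => //.
  by rewrite -[X in measurable X]setTI; exact: measurable_fst.
apply: measurable_forall => i; apply: measurable_forall => n.
apply: measurable_imply_prop => il; apply: measurable_imply; first exact: mgz.
apply: measurable_forall_ord => j.
rewrite -[X in measurable X]setTI; apply: measurable_fun_le => //.
  by apply: measurable_funM => //; exact: mYo.
apply: measurable_funM => //.
exact: (measurableT_comp (measurable_eval (s_in_X j)) measurable_fst).
Qed.

Lemma measurable_extremal_prob (B : set (path_space X)) l : measurable B ->
  measurable_fun setT (fun y => P (extremal_event B l (Y ^~ y))).
Proof.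
move=> mB; have mid := measurable_fun_sub_sigma (@m_others l).
have ms := measurable_section_prob P mid (@m_extremal_set B l mB).
exact: (measurableT_comp ms (measurable_path mY)).
Qed.

Lemma measurable_extremal_event (B : set (path_space X)) l : measurable B ->
  measurable [set w | extremal_event B l (Ys l ^~ w) w].
Proof.
move=> mB; have mid := measurable_fun_sub_sigma (@m_others l).
have mp := measurable_fun_pair (measurable_path (mYs l)) mid.
by have := mp measurableT _ (@m_extremal_set B l mB); rewrite setTI.
Qed.

(** [Ys l] is independent of everything generated by [others l] and has the law of [Y], so it can be
    integrated out separately. *)
Lemma prob_extremal_event (B : set (path_space X)) l : measurable B ->
  P [set w | extremal_event B l (Ys l ^~ w) w] =
  \int[Q]_y P (extremal_event B l (Y ^~ y)).
Proof.
move=> mB; have mid := measurable_fun_sub_sigma (@m_others l).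
have ms := measurable_section_prob P mid (@m_extremal_set B l mB).
have mpY := measurable_path mY.
pose pY : {mfun TY >-> path_space X} := HB.pack (fun y => Y ^~ y : path_space X)
  (isMeasurableFun.Build _ _ _ _ _ mpY).
have mpYs := measurable_path (mYs l).
have := @prob_decouple _ _ _ _ _ _ _ P (distribution Q pY) (fun w => Ys l ^~ w : path_space X)
  (id : Omega -> g_sigma_algebraType (others l)) mpYs mid _ _ (@m_extremal_set B l mB).
move=> ->.
  rewrite ge0_integral_distribution//; exact: ms.
move=> C A mC oA.
transitivity (P [set w | C (Ys l ^~ w)] * P A); last by rewrite (law_Ys l mC).
apply: (@indep_g_sigma _ _ _ P _ (others l)) => //.
- by have := mpYs measurableT C mC; rewrite setTI.
- move=> A' oA'; exact: indep_others.
Qed.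

End decoupled_extremal_sum.

(** * Elementary bounds for geometric series and extended inverses *)

Lemma expR_geometric_ub (R : realType) (dl c : R) : (0 < dl)%R -> (0 < c)%R ->
  (dl / (1 - expR (- (dl * c))) <= dl + c^-1)%R.
Proof.
move=> dl0 c0; have x0 : (0 < dl * c)%R by rewrite mulr_gt0.
have e1 : (expR (- (dl * c)) < 1)%R by rewrite -expR0 ltr_expR oppr_lt0.
rewrite ler_pdivrMr ?subr_gt0//.
have := expR_ge1Dx (dl * c); rewrite expRN => ex.
have ep := expR_gt0 (dl * c).
rewrite -(ler_pM2r ep) -(ler_pM2r c0) mulrBr !mulrBl mulr1 divfK ?gt_eqF//.
have -> : ((dl + c^-1) * expR (dl * c) * c = (dl * c + 1) * expR (dl * c))%R.
  by rewrite mulrAC mulrDl mulVf ?gt_eqF.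
have -> : ((dl + c^-1) * c = dl * c + 1)%R by rewrite mulrDl mulVf ?gt_eqF.
(* With x = dl c, what remains is 1 + x <= exp x. *)
nra.
Qed.

Lemma expR_geometric_lb (R : realType) (dl c : R) : (0 < dl)%R -> (0 < c)%R ->
  (c^-1 - dl <= dl * expR (- (dl * c)) / (1 - expR (- (dl * c))))%R.
Proof.
move=> dl0 c0; have x0 : (0 < dl * c)%R by rewrite mulr_gt0.
have e1 : (expR (- (dl * c)) < 1)%R by rewrite -expR0 ltr_expR oppr_lt0.
rewrite ler_pdivlMr ?subr_gt0// -(ler_pM2r c0).
have := expR_ge1Dx (- (dl * c)); set e := expR _ => ex.
have -> : ((c^-1 - dl) * (1 - e) * c = (1 - dl * c) * (1 - e))%R.
  by rewrite mulrAC mulrBl mulVf ?gt_eqF.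
have e0 : (0 < e)%R by exact: expR_gt0.
(* With x = dl c, what remains is 1 - x <= exp (- x). *)
nra.
Qed.

Lemma nneseries_geometric (R : realType) (a q : R) : (0 <= a)%R -> (0 <= q < 1)%R ->
  \sum_(n <oo) (a * q ^+ n)%:E = (a / (1 - q))%:E.
Proof.
move=> a0 /andP[q0 q1].
under eq_fun do rewrite sumEFin.
apply/cvg_lim => //; apply: cvg_EFin; first exact: nearW.
by apply: cvg_geometric_series; rewrite ger0_norm.
Qed.

(** It suffices to test real upper bounds of [c]: for c = 0 they can be arbitrarily small, and for c
    = +oo the inverse is 0. *)
Lemma inve_le (R : realType) (c x : \bar R) : 0 <= c -> 0 <= x ->
  (forall r : R, (0 < r)%R -> c <= r%:E -> (r^-1)%:E <= x) -> c^-1 <= x.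
Proof.
move=> c0 x0 cx; case: c c0 cx => [c||]//.
rewrite lee_fin le_eqVlt => /predU1P[<-|c0] cx; last by rewrite inver gt_eqF// cx.
rewrite inve0 leye_eq; apply/eqP/eqyP => A A0.
by rewrite -(invrK A) cx ?lee_fin ?invr_gt0// ltW ?invr_gt0.
Qed.

(** The dual reduction, to real lower bounds of [c]: for c = +oo they can be arbitrarily large, and
    for c = 0 the right side is infinite. *)
Lemma le_inve (R : realType) (c x : \bar R) (e dl : R) : 0 <= c -> (0 < e)%R -> (0 < dl)%R ->
  (forall r : R, (0 < r)%R -> r%:E <= c -> x <= (e * (dl + r^-1))%:E) ->
  x <= e%:E * (dl%:E + c^-1).
Proof.
move=> c0 e0 dl0 cx; case: c c0 cx => [c||]//.
  rewrite lee_fin le_eqVlt => /predU1P[<-|c0] cx; last by rewrite inver gt_eqF// -EFinD -EFinM cx.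
  by rewrite inve0 addey// gt0_muley ?lte_fin// leey.
move=> _ cx; rewrite invey adde0 -EFinM.
apply/lee_addgt0Pr => r r0; rewrite -EFinD.
have -> : (e * dl + r = e * (dl + (e / r)^-1))%R by rewrite invf_div mulrDr mulrCA mulfV
  ?gt_eqF// mulr1.
by apply: cx; rewrite ?divr_gt0 ?leey.
Qed.

(** * Counting failed comparisons against the largest ratio *)

Section ratio_count.
Context (R : realType) (k : nat) (u v : 'I_k -> R).
Hypotheses (u0 : forall j, (0 <= u j)%R) (v0 : forall j, (0 <= v j)%R).

Let Z : \bar R := \big[maxe/-oo]_(j < k) ((u j)%:E / (v j)%:E).

Let leZ j : (u j)%:E / (v j)%:E <= Z.
Proof. by rewrite /Z (bigD1 j)//= le_max lexx. Qed.

Lemma max_ratio_ge0 : (0 < k)%N -> 0 <= Z.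
Proof.
move=> k0; apply: le_trans (leZ (Ordinal k0)).
by rewrite mule_ge0 ?inve_ge0 ?lee_fin.
Qed.

(** The comparison fails at least for every n with n + 1 < m u_j / v_j, and there are at least m u_j
    / v_j - 2 of these. *)
Lemma max_ratio_le_count m : (0 < m)%N ->
  Z <= (m%:R^-1)%:E * (\sum_(n <oo) (~~ `[< forall j, m%:R * u j <= n.+1%:R * v j >]%R)%:R%:E +
    2%:E).
Proof.
move=> m0; set S := \sum_(n <oo) _.
have S0 : 0 <= S by apply: nneseries_ge0 => n _ _; rewrite lee_fin.
have m1 : (0 < m%:R^-1 :> R)%R by rewrite invr_gt0 ltr0n.
rewrite /Z; elim/big_ind : _ => [|x y xS yS|j _]; first exact: leNye.
  by rewrite ge_max xS.
have nS (N : nat) : (forall n, (n < N)%N -> (n.+1%:R * v j < m%:R * u j)%R) -> N%:R%:E <= S.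
  move=> nN; apply: le_trans (nneseries_lim_ge N _); last by move=> n _ _; rewrite lee_fin.
  rewrite big_mkord sumEFin lee_fin -natr_sum ler_nat.
  rewrite (eq_bigr (fun=> 1%N)) ?sum1_card ?card_ord// => i _.
  by case: asboolP => // /(_ j); rewrite leNgt nN.
have [uj0|uj0] := eqVneq (u j) 0%R.
  by rewrite uj0 mul0e mule_ge0// ?lee_fin ?(ltW m1)// adde_ge0.
have ujp : (0 < u j)%R by rewrite lt_def uj0 u0.
have [vj0|vj0] := eqVneq (v j) 0%R.
  (* If v_j = 0 < u_j, the ratio is infinite and every comparison fails. *)
  rewrite (_ : S = +oo) ?addye// ?gt0_muley ?lte_fin ?leey//.
  apply/eqyP => A A0; apply: le_trans (nS (Num.truncn A).+1 _).
    by rewrite lee_fin ltW// Num.Theory.truncnS_gt.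
  by move=> n _; rewrite vj0 mulr0 mulr_gt0// ltr0n.
have vjp : (0 < v j)%R by rewrite lt_def vj0 v0.
rewrite inver (negbTE vj0) -EFinM.
pose r := (m%:R * u j / v j)%R.
have r0 : (0 <= r)%R by rewrite divr_ge0// mulr_ge0.
have -> : (u j / v j = m%:R^-1 * r)%R by rewrite /r -mulrA mulKf// pnatr_eq0 -lt0n.
rewrite EFinM lee_pmul2l ?lte_fin//.
(* The indices below floor(r) - 1 satisfy n + 1 < floor(r) <= r; this loss of one and the rounding
   of [r] account for the 2. *)
apply: (@le_trans _ _ ((Num.truncn r).-1%:R%:E + 2%:E)).
  rewrite -EFinD lee_fin -natrD ltW// (lt_le_trans (Num.Theory.truncnS_gt r))// ler_nat.
  by rewrite addn2 ltnS leqSpred.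
apply: leeD => //; apply: nS => n nr.
rewrite -ltr_pdivlMr//; have /andP[tr _] := Num.Theory.truncn_itv r0.
by apply: lt_le_trans tr; rewrite ltr_nat; move: nr; case: (Num.truncn r).
Qed.

(** When all v_j are positive, a failure at n forces n < (m+1) Z, which leaves at most floor((m+1)
    Z) + 1 values of n. *)
Lemma count_le_max_ratio m : (0 < k)%N -> (forall j, (0 < v j)%R) ->
  \sum_(n <oo) (~~ `[< forall j, m.+1%:R * u j <= n%:R * v j >]%R)%:R%:E <= m.+1%:R%:E * Z + 1%:E.
Proof.
move=> k0 vp; have := max_ratio_ge0 k0; have := leZ.
case: Z => [z|_ _|//]; last by rewrite gt0_muley ?lte_fin// addye// leey.
rewrite lee_fin => zZ z0; set r := (m.+1%:R * z)%R.
have r0 : (0 <= r)%R by rewrite mulr_ge0.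
apply: (@le_trans _ _ (Num.truncn r).+1%:R%:E); last first.
  rewrite -EFinM -EFinD lee_fin -natr1 lerD2r.
  by have /andP[] := Num.Theory.truncn_itv r0.
apply: lime_le; first by apply: is_cvg_nneseries => n _ _; rewrite lee_fin.
apply: nearW => N; rewrite sumEFin lee_fin -natr_sum ler_nat.
apply: (@leq_trans (\sum_(0 <= n < N | (n < (Num.truncn r).+1)%N) 1)).
  rewrite [leqRHS]big_mkcond; apply: leq_sum => n _.
  case: asboolP => //= /existsNP[j /negP]; rewrite -ltNge => nj.
  rewrite ifT// ltnS Num.Theory.truncn_ge_nat//.
  have := zZ j; rewrite inver gt_eqF// -EFinM lee_fin => uvz.
  rewrite ltW// (lt_le_trans _ (_ : (m.+1%:R * (u j / v j) <= r)%R))//.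
    by rewrite mulrA ltr_pdivlMr.
  by rewrite ler_pM2l.
rewrite sum1_count -size_filter -[leqRHS](size_iota 0).
apply: uniq_leq_size; first by rewrite filter_uniq// iota_uniq.
by move=> n; rewrite mem_filter mem_iota/= => /andP[].
Qed.
End ratio_count.

Lemma nneseries_measure_bigcup d (T : measurableType d) (R : realType)
    (mu : {measure set T -> \bar R}) (F : nat -> set T) :
  (forall i, measurable (F i)) -> trivIset setT F ->
  \sum_(i <oo) mu (F i) = mu (\bigcup_i F i).
Proof.
by move=> mF tF; rewrite measure_bigcup//; apply: eq_eseriesl => i; rewrite in_setT.
Qed.

(** * Bounds for the concurrence probability at a fixed mesh *)

Section concurrence.
Context (R : realType) (dim : nat) (X : set 'rV[R]_dim)
  (dO : measure_display) (Omega : measurableType dO) (P : probability Omega R)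
  (zeta : nat -> Omega -> R) (Ys : nat -> 'rV[R]_dim -> Omega -> R)
  (dY : measure_display) (TY : measurableType dY) (Q : probability TY R)
  (Y : 'rV[R]_dim -> TY -> R)
  (dYt : measure_display) (TYt : measurableType dYt) (Qt : probability TYt R)
  (Yt : 'rV[R]_dim -> TYt -> R).
Hypotheses (Y_spectral : spectral_process X Q Y) (Yt_copy : is_copy X Qt Yt Q Y)
  (eta_repr : spectral_representation X P zeta Ys Q Y).
Context (k : nat) (k0 : (0 < k)%N) (s : 'I_k -> 'rV[R]_dim) (s_in_X : forall j, X (s j)).

Let mY u : X u -> measurable_fun setT (Y u).
Proof. by move=> Xu; case: Y_spectral => [[h _ _] _ _]; exact: h. Qed.

Let mYt u : X u -> measurable_fun setT (Yt u).
Proof. by move=> Xu; case: Yt_copy => [[h _ _] _]; exact: h. Qed.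

Let mYs i u : X u -> measurable_fun setT (Ys i u).
Proof. by move=> Xu; case: eta_repr => [_ /(_ i)[[h _ _] _] _ _]; exact: h. Qed.

Let Y0 y j : (0 <= Y (s j) y)%R.
Proof. by case: Y_spectral => [[_ h _] _ _]; exact: h. Qed.

Let Yt0 v j : (0 <= Yt (s j) v)%R.
Proof. by case: Yt_copy => [[_ h _] _]; exact: h. Qed.

Let Ys0 i w j : (0 <= Ys i (s j) w)%R.
Proof. by case: eta_repr => [_ /(_ i)[[_ h _] _] _ _]; exact: h. Qed.

Let Z y v : \bar R := \big[maxe/-oo]_(j < k) ((Yt (s j) v)%:E / (Y (s j) y)%:E).
Let c y : \bar R := \int[Qt]_v Z y v.

Let Z0 y v : 0 <= Z y v.
Proof. exact: max_ratio_ge0. Qed.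

Let c0 y : 0 <= c y.
Proof. exact: integral_ge0. Qed.

Let mZ : measurable_fun setT (fun x : TY * TYt => Z x.1 x.2).
Proof.
rewrite /Z; elim: (index_enum _) => [|j r IH].
  by under eq_fun do rewrite big_nil; exact: measurable_cst.
under eq_fun do rewrite big_cons; apply: measurable_maxe => //.
apply: emeasurable_funM.
  by apply/measurable_EFinP; exact: (measurableT_comp (mYt (s_in_X j)) measurable_snd).
apply: measurable_inve => [|x]; last by rewrite lee_fin.
by apply/measurable_EFinP; exact: (measurableT_comp (mY (s_in_X j)) measurable_fst).
Qed.

Let mZy y : measurable_fun setT (Z y).
Proof. exact: (measurableT_comp mZ (measurable_pair1 y)). Qed.

Let mc : measurable_fun setT c.
Proof.
by apply: (@measurable_fun_fubini_tonelli_F _ _ _ _ _ Qt (fun x => Z x.1 x.2)) => // x; exact: Z0.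
Qed.

Let mcV : measurable_fun setT (fun y => (c y)^-1).
Proof. exact: measurable_inve. Qed.

Let law_Yt (C : set (path_space X)) : measurable C ->
  Q [set y | C (Y ^~ y)] = Qt [set v | C (Yt ^~ v)].
Proof. by move=> mC; case: Yt_copy => _ h; rewrite h. Qed.

Let co_prob a b n f :
  (1 - fine (Q [set y | scaled_le s a b n f (Y ^~ y)]))%:E =
  \int[Qt]_v (~~ `[< scaled_le s a b n f (Yt ^~ v) >])%:R%:E.
Proof.
have mC := measurable_scaled_ler s_in_X a b n f.
have mS : measurable [set v | scaled_le s a b n f (Yt ^~ v)].
  by have := measurable_path mYt measurableT mC; rewrite setTI.
rewrite (law_Yt mC) EFinB fineK ?fin_num_measure// -(probability_setC Qt mS).
rewrite -[X in Qt X]setIT -integral_indic//; last exact: measurableC.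
by apply: eq_integral => v _; rewrite indicE in_setC; congr (~~ _)%:R%:E.
Qed.

(** The layer-cake step: summing failure probabilities over the cells gives the expected number of
    failed comparisons. *)
Let integral_count a b f :
  \sum_(n <oo) (1 - fine (Q [set y | scaled_le s a b n f (Y ^~ y)]))%:E =
  \int[Qt]_v \sum_(n <oo) (~~ `[< scaled_le s a b n f (Yt ^~ v) >])%:R%:E.
Proof.
rewrite integral_nneseries//.
- by apply: eq_eseriesr => n _; exact: co_prob.
- move=> n; rewrite (_ : (fun v => _) = EFin \o \1_(~` [set v | scaled_le s a b n f (Yt ^~ v)])).
    apply/measurable_EFinP; apply: measurable_indic; apply: measurableC.
    by have := measurable_path mYt measurableT (measurable_scaled_ler s_in_X a b n f);
      rewrite setTI.
  by apply/funext => v; rewrite /= indicE in_setC.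
Qed.

Let measurable_count a b f : measurable_fun setT
  (fun v => \sum_(n <oo) (~~ `[< scaled_le s a b n f (Yt ^~ v) >])%:R%:E : \bar R).
Proof.
apply: ge0_emeasurable_sum => // n _;
  rewrite (_ : (fun v => _) = EFin \o \1_(~` [set v | scaled_le s a b n f (Yt ^~ v)])).
  apply/measurable_EFinP; apply: measurable_indic; apply: measurableC.
  by have := measurable_path mYt measurableT (measurable_scaled_ler s_in_X a b n f);
    rewrite setTI.
by apply/funext => v; rewrite /= indicE in_setC.
Qed.

Let co_prob_ge0 a b n f : (0 <= 1 - fine (Q [set y | scaled_le s a b n f (Y ^~ y)]))%R.
Proof. by rewrite -lee_fin co_prob integral_ge0. Qed.

Section fixed_mesh.
Context (dl : R) (dl0 : (0 < dl)%R).

Let F a b m f := \sum_(l <oo) P [set w | grid dl m (zeta l w) /\ forall i n, i != l ->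
    grid dl n (zeta i w) -> scaled_le s a b n f (Ys i ^~ w)].

Let S a b f K := (\sum_(0 <= n < K) (1 - fine (Q [set y | scaled_le s a b n f (Y ^~ y)])))%R.

Let FS a b m f : (fun K => (dl * expR (- (dl * S a b f K)))%:E) @ \oo --> F a b m f.
Proof.
have := @section_sum_cvg _ _ _ _ _ _ _ _ _ _ _ _ mY eta_repr _ _ s_in_X _ dl0 m a b f.
by under eq_fun do rewrite -mulr_sumr.
Qed.

Let F_upper m y (r : R) : (0 < r)%R -> r%:E <= c y ->
  F m%:R (fun n => n.+1%:R)%R m (Y ^~ y) <=
  (dl * expR (3 * dl) * expR (- (dl * r)) ^+ m)%:E.
Proof.
move=> r0 rc; set a := m%:R%R; set b := fun n => _; set f := Y ^~ y.
have ndS : nondecreasing_seq (S a b f).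
  by apply/nondecreasing_seqP => n; rewrite /S big_nat_recr//= lerDl co_prob_ge0.
(* The full series is at least m r - 2 when m > 0; giving up one more unit lets a finite partial sum
   reach the bound. For m = 0 the bound is negative. *)
have [K SK] : exists K, (m%:R * r - 3 <= S a b f K)%R.
  apply: contrapT => /forallNP SK.
  have : \int[Qt]_v \sum_(n <oo) (~~ `[< scaled_le s a b n f (Yt ^~ v) >])%:R%:E <=
    (m%:R * r - 3)%:E.
    rewrite -integral_count; apply: lime_le.
      by apply: is_cvg_nneseries => n _ _; rewrite lee_fin co_prob_ge0.
    apply: nearW => K; rewrite sumEFin lee_fin ltW// ltNge; apply/negP; exact: SK.
  apply/negP; rewrite -ltNge.
  set J := \int[Qt]_v _.
  have J0 : 0 <= J.
    by apply: integral_ge0 => v _; apply: nneseries_ge0 => n _ _; rewrite lee_fin.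
  have [m0|m0] := posnP m.
    by rewrite m0 mul0r sub0r (lt_le_trans _ J0)// lte_fin oppr_lt0.
  have cJ : c y <= (m%:R^-1)%:E * (J + 2%:E).
    have -> : J + 2%:E = \int[Qt]_v
      (\sum_(n <oo) (~~ `[< scaled_le s a b n f (Yt ^~ v) >])%:R%:E + 2%:E).
      rewrite ge0_integralD//; first by rewrite integral_cst// [X in _ * X]probability_setT mule1.
      by move=> v _; apply: nneseries_ge0 => n _ _; rewrite lee_fin.
    rewrite -ge0_integralZl_EFin//; last 2 first.
    - by move=> v _; rewrite adde_ge0// nneseries_ge0.
    - by apply: emeasurable_funD => //; exact: measurable_count.
    apply: ge0_le_integral => //.
    - by apply: measurable_funeM; apply: emeasurable_funD => //; exact: measurable_count.
    - by move=> v _; exact: max_ratio_le_count.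
  move: cJ; case: J J0 => [J|_ _|//]; last by rewrite ltry.
  move=> J0 cJ; rewrite lte_fin; have := le_trans rc cJ.
  rewrite -EFinD -EFinM lee_fin ler_pdivlMl ?ltr0n// => mr.
  by rewrite ltrBlDr (le_lt_trans mr)// ltrD2l ltr_nat.
rewrite -(cvg_lim _ (@FS a b m f))//; apply: lime_le; first by apply/cvg_ex; exists (F a b m f);
  exact: (@FS a b m f).
exists K => // K' /= KK'; rewrite lee_fin -mulrA ler_pM2l// -expRM_natl -expRD ler_expR.
have := le_trans SK (ndS _ _ KK'); rewrite -(ler_pM2l dl0).
lra.
Qed.

Let F_lower m y (r : R) : (forall j, (0 < Y (s j) y)%R) -> c y <= r%:E ->
  (dl * expR (- dl) * expR (- (dl * r)) ^+ m.+1)%:E <=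
  F m.+1%:R (fun n => n%:R)%R m (Y ^~ y).
Proof.
move=> Yp cr; set a := m.+1%:R%R; set b := fun n => _; set f := Y ^~ y.
(* The expected count is at most (m+1) c + 1, which bounds every partial sum. *)
have SK K : (S a b f K <= m.+1%:R * r + 1)%R.
  rewrite -lee_fin /S -sumEFin; apply: le_trans (nneseries_lim_ge K _) _.
    by move=> n _ _; rewrite lee_fin co_prob_ge0.
  rewrite integral_count.
  apply: (@le_trans _ _ (\int[Qt]_v (m.+1%:R%:E * Z y v + 1%:E))).
    apply: ge0_le_integral => //.
    - by move=> v _; apply: nneseries_ge0 => n _ _; rewrite lee_fin.
    - by apply: emeasurable_funD => //; exact: measurable_funeM.
    - move=> v _; exact: (@count_le_max_ratio _ _ (fun j => Yt (s j) v) (fun j => Y (s j) y)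
      (Yt0 v) (Y0 y) m k0 Yp).
  rewrite ge0_integralD//; last 2 first.
  - by move=> v _; rewrite mule_ge0.
  - exact: measurable_funeM.
  rewrite integral_cst// [X in _ + _ * X]probability_setT mule1 ge0_integralZl_EFin// EFinD EFinM.
  by rewrite leeD2r// lee_pmul2l// lte_fin.
rewrite -(cvg_lim _ (@FS a b m f))//; apply: lime_ge; first by apply/cvg_ex; exists (F a b m f);
  exact: (@FS a b m f).
apply: nearW => K; rewrite lee_fin -mulrA ler_pM2l// -expRM_natl -expRD ler_expR.
have := SK K; rewrite -(ler_pM2l dl0).
lra.
Qed.

Let extremal_prob_eq a b m (B : set (path_space X)) f : B f ->
  \sum_(l <oo) P (extremal_event zeta Ys s dl m a b B l f) = F a b m f.
Proof.
move=> Bf; apply: eq_eseriesr => l _; congr (P _).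
by apply/seteqP; split => w [? ?].
Qed.

(** Tonelli brings the sum over the points inside, at a frozen path, where its value is known for
    each cell [m]. *)
Let sum_extremal (a : nat -> R) (b : nat -> nat -> R) (B : set (path_space X)) : measurable B ->
  \sum_(l <oo) \sum_(m <oo) P [set w | extremal_event zeta Ys s dl m (a m) (b m) B l
    (Ys l ^~ w) w] =
  \int[Q]_y \sum_(m <oo) \sum_(l <oo) P (extremal_event zeta Ys s dl m (a m) (b m) B l (Y ^~ y)).
Proof.
move=> mB; have mext m l := measurable_extremal_prob mY eta_repr s_in_X dl0 m (a m) (b m) l mB.
rewrite nneseries_interchange// integral_nneseries//; last 2 first.
- by move=> m; apply: ge0_emeasurable_sum => // l _; exact: mext.
- by move=> m y _; exact: nneseries_ge0.
apply: eq_eseriesr => m _; rewrite integral_nneseries//.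
by apply: eq_eseriesr => l _; exact: prob_extremal_event.
Qed.

Let sumF_upper y : \sum_(m <oo) F m%:R (fun n => n.+1%:R)%R m (Y ^~ y) <=
  (expR (3 * dl))%:E * (dl%:E + (c y)^-1).
Proof.
apply: le_inve => // [|r r0 rc]; first exact: expR_gt0.
have q01 : (0 <= expR (- (dl * r)) < 1)%R.
  by rewrite expR_ge0/= -expR0 ltr_expR oppr_lt0 mulr_gt0.
have e0 : (0 <= dl * expR (3 * dl))%R by rewrite mulr_ge0 ?expR_ge0// ltW.
apply: (@le_trans _ _ (\sum_(m <oo) (dl * expR (3 * dl) * expR (- (dl * r)) ^+ m)%:E)).
  apply: lee_nneseries => [m _ _|m _]; last exact: F_upper.
  exact: nneseries_ge0.
rewrite nneseries_geometric// lee_fin (mulrC dl) -mulrA ler_pM2l ?expR_gt0//.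
exact: expR_geometric_ub.
Qed.

Let sumF_lower y : (forall j, (0 < Y (s j) y)%R) ->
  (c y)^-1 <= (expR dl)%:E * \sum_(m <oo) F m.+1%:R (fun n => n%:R)%R m (Y ^~ y) + dl%:E.
Proof.
move=> Yp.
have F0 : 0 <= \sum_(m <oo) F m.+1%:R (fun n => n%:R)%R m (Y ^~ y).
  by apply: nneseries_ge0 => m _ _; exact: nneseries_ge0.
apply: inve_le => // [|r r0 cr].
  by rewrite adde_ge0// ?mule_ge0// lee_fin ?expR_ge0// ltW.
have q01 : (0 <= expR (- (dl * r)) < 1)%R.
  by rewrite expR_ge0/= -expR0 ltr_expR oppr_lt0 mulr_gt0.
have e0 : (0 <= dl * expR (- dl) * expR (- (dl * r)))%R by rewrite !mulr_ge0 ?expR_ge0// ltW.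
apply: (@le_trans _ _ ((expR dl)%:E *
    \sum_(m <oo) (dl * expR (- dl) * expR (- (dl * r)) * expR (- (dl * r)) ^+ m)%:E + dl%:E));
      last first.
  rewrite leeD2r// lee_pmul2l ?lte_fin ?expR_gt0//.
  apply: lee_nneseries => [m _ _|m _]; first by rewrite lee_fin mulr_ge0// exprn_ge0// expR_ge0.
  by rewrite -mulrA -exprS; exact: F_lower.
rewrite nneseries_geometric// -EFinM -EFinD lee_fin -lerBlDr.
apply: le_trans (expR_geometric_lb dl0 r0) _.
rewrite (mulrC dl (expR (- dl))) -!mulrA [leRHS]mulrA -expRD subrr expR0 mul1r lexx//.
Qed.

Let concurrence := [set w | exists l : nat, forall j : 'I_k,
  max_stable_process zeta Ys (s j) w = (extremal_function zeta Ys l (s j) w)%:E].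

Let concurrenceE : concurrence = \bigcup_l [set w | forall j i,
  (extremal_function zeta Ys i (s j) w <= extremal_function zeta Ys l (s j) w)%R].
Proof.
apply/seteqP; split => w.
  move=> [l lE]; exists l => // j i; rewrite -lee_fin -lE.
  by apply: ereal_sup_ubound; exists i.
move=> [l _ lE]; exists l => j; apply/eqP; rewrite eq_le; apply/andP; split.
  by apply: ge_ereal_sup => _ [i _ <-]; rewrite lee_fin; exact: lE.
by apply: ereal_sup_ubound; exists l.
Qed.

Let mzeta i : measurable_fun setT (zeta i).
Proof. by case: eta_repr => -[h _ _ _] _ _ _; exact: h. Qed.

Let measurable_concurrence : measurable concurrence.
Proof.
rewrite concurrenceE; apply: bigcup_measurable => l _.
apply: measurable_forall_ord => j; apply: measurable_forall => i.
rewrite -[X in measurable X]setTI.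
by apply: measurable_fun_le => //; apply: measurable_funM => //; exact: mYs.
Qed.

Let zeta0 i w : (0 < zeta i w)%R.
Proof. by case: eta_repr => zP _ _ _; exact: (zeta_gt0 zP). Qed.

Let mD m a b (B : set (path_space X)) l : measurable B ->
  measurable [set w | extremal_event zeta Ys s dl m a b B l (Ys l ^~ w) w].
Proof. by move=> mB; exact: (measurable_extremal_event eta_repr s_in_X dl0). Qed.

Let I := \int[Q]_y (c y)^-1.

Let concurrence_upper : P concurrence <= (expR (3 * dl))%:E * (dl%:E + I).
Proof.
pose D l m := [set w | extremal_event zeta Ys s dl m m%:R (fun n => n.+1%:R)%R
  (setT : set (path_space X)) l (Ys l ^~ w) w].
have mDT l m : measurable (D l m) by exact: mD.
have cD : concurrence `<=` \bigcup_l \bigcup_m D l m.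
  (* The cells give m dl zeta_l <= 1 < (n+1) dl zeta_i, and extremality gives zeta_i Y_i <= zeta_l
     Y_l. Hence m Y_i <= (n+1) dl zeta_i m Y_i <= m dl (n+1) zeta_l Y_l <= (n+1) Y_l. *)
  rewrite concurrenceE => w [l _ lE]; exists l => //.
  have [m gm] := grid_cover dl0 (zeta0 l w); exists m => //; split => // i n il gn j.
  have := lE j i; rewrite /extremal_function => le_il.
  move: gm gn => [zl0 [ml _]] [zi0 [_ ni]].
  have Yl := Ys0 l w j; have Yi := Ys0 i w j.
  apply: (@le_trans _ _ (n.+1%:R * dl * zeta i w * (m%:R * Ys i (s j) w))%R).
    by rewrite ler_peMl ?mulr_ge0// ltW.
  rewrite (_ : _ * _ = m%:R * dl * n.+1%:R * (zeta i w * Ys i (s j) w))%R; last by ring.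
  apply: (@le_trans _ _ (m%:R * dl * n.+1%:R * (zeta l w * Ys l (s j) w))%R).
    by rewrite ler_wpM2l// !mulr_ge0// ltW.
  rewrite (_ : _ * _ = (m%:R * dl * zeta l w) * (n.+1%:R * Ys l (s j) w))%R; last by ring.
  by rewrite ler_piMl ?mulr_ge0.
apply: (@le_trans _ _ (\sum_(l <oo) \sum_(m <oo) P (D l m))).
  have mDl l : measurable (\bigcup_m D l m) by exact: bigcupT_measurable.
  apply: le_trans (measure_sigma_subadditive P mDl measurable_concurrence cD) _.
  apply: lee_nneseries => // l _.
  exact: (measure_sigma_subadditive P (mDT l) (mDl l)).
rewrite (sum_extremal (fun m => m%:R)%R (fun _ n => n.+1%:R)%R measurableT).
have -> : (expR (3 * dl))%:E * (dl%:E + I) = \int[Q]_y ((expR (3 * dl))%:E * (dl%:E + (c y)^-1)).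
  rewrite ge0_integralZl_EFin ?expR_ge0//; last 2 first.
  - by move=> y _; rewrite adde_ge0 ?inve_ge0// lee_fin ltW.
  - exact: emeasurable_funD.
  rewrite ge0_integralD//; last 2 first.
  - by move=> y _; rewrite lee_fin ltW.
  - by move=> y _; rewrite inve_ge0.
  by rewrite integral_cst// [X in _ * (_ * X + _)]probability_setT mule1.
apply: ge0_le_integral => //.
- by move=> y _; apply: nneseries_ge0 => m _ _; exact: nneseries_ge0.
- apply: ge0_emeasurable_sum => [m y _ _|m _]; first exact: nneseries_ge0.
  by apply: ge0_emeasurable_sum => // l _;
    exact: (measurable_extremal_prob mY eta_repr s_in_X dl0 _ _ _ l measurableT).
- by apply: measurable_funeM; exact: emeasurable_funD.
move=> y _; apply: le_trans (sumF_upper y).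
apply: lee_nneseries => [m _ _|m _]; first exact: nneseries_ge0.
by rewrite (@extremal_prob_eq _ _ _ setT).
Qed.

Let mean_Yt j : \int[Qt]_v (Yt (s j) v)%:E = 1.
Proof.
have mpY := measurable_path mY.
pose pY : {mfun TY >-> path_space X} := HB.pack (fun y => Y ^~ y : path_space X)
  (isMeasurableFun.Build _ _ _ _ _ mpY).
have mpYt := measurable_path mYt.
pose pYt : {mfun TYt >-> path_space X} := HB.pack (fun y => Yt ^~ y : path_space X)
  (isMeasurableFun.Build _ _ _ _ _ mpYt).
have me : measurable_fun setT (fun f : path_space X => `|f (s j)|%:E).
  by apply/measurable_EFinP; apply: measurableT_comp => //; exact: measurable_eval.
case: Y_spectral => _ /(_ _ (s_in_X j)) <- _; rewrite unlock.
transitivity (\int[distribution Qt pYt]_f `|f (s j)|%:E).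
  rewrite ge0_integral_distribution//.
  by apply: eq_integral => v _; rewrite /= ger0_norm.
transitivity (\int[distribution Q pY]_f `|f (s j)|%:E).
  by apply: eq_measure_integral => A mA _; exact/esym/law_Yt.
rewrite ge0_integral_distribution//.
by apply: eq_integral => y _; rewrite /= ger0_norm.
Qed.

(** The j-th ratio is infinite wherever [Yt (s j)] is positive and 0 elsewhere, so it dominates r
    [Yt (s j)] for every r > 0; the mean of the latter is r. *)
Let c_infty y j : Y (s j) y = 0%R -> c y = +oo.
Proof.
move=> Yj; apply/eqyP => r r0.
rewrite -[r%:E]mule1 -(mean_Yt j) -ge0_integralZl_EFin ?(ltW r0)//; last 2 first.
- by move=> v _; rewrite lee_fin.
- by apply/measurable_EFinP; exact: mYt.
apply: ge0_le_integral => //.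
- by move=> v _; rewrite mule_ge0 ?lee_fin// ltW.
- by apply: measurable_funeM; apply/measurable_EFinP; exact: mYt.
move=> v _; apply: le_trans (_ : (Yt (s j) v)%:E / (Y (s j) y)%:E <= _).
  rewrite Yj inve0 muleC; have := Yt0 v j; rewrite le_eqVlt => /predU1P[<-|Yp].
    by rewrite !mul0e.
  by rewrite gt0_muley ?leey.
by rewrite /Z (bigD1 j)//= le_max lexx.
Qed.

Let concurrence_lower : I <= (expR dl)%:E * P concurrence + dl%:E.
Proof.
pose B : set (path_space X) := [set f | forall j, (0 < f (s j))%R].
have mB : measurable B.
  apply: measurable_forall_ord => j.
  have := measurable_eval (s_in_X j) measurableT (measurable_itv `]0%R, +oo[).
  rewrite setTI; congr measurable; apply/funext => f /=.
  by rewrite in_itv/= andbT.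
pose D l m := [set w | extremal_event zeta Ys s dl m m.+1%:R (fun n => n%:R)%R B l (Ys l ^~ w) w].
have mDB l m : measurable (D l m) by exact: mD.
(* Here (m+1) dl zeta_i Y_i <= n dl zeta_i Y_l <= Y_l < (m+1) dl zeta_l Y_l; the last inequality is
   strict because [B] makes Y_l positive. *)
have Dlt l m w : D l m w -> forall i j, i != l ->
    (extremal_function zeta Ys i (s j) w < extremal_function zeta Ys l (s j) w)%R.
  move=> [Bl [zl0 [_ ml]] le_il] i j il.
  have [n gn] := grid_cover dl0 (zeta0 i w); have := le_il i n il gn j => leY.
  move: gn => [zi0 [ni _]]; have Yl := Bl j; rewrite /extremal_function.
  have d0 : (0 < m.+1%:R * dl)%R by rewrite mulr_gt0.
  rewrite -(ltr_pM2l d0).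
  rewrite (_ : m.+1%:R * dl * (zeta i w * Ys i (s j) w) = dl * zeta i w *
    (m.+1%:R * Ys i (s j) w))%R; last by ring.
  apply: (@le_lt_trans _ _ (dl * zeta i w * (n%:R * Ys l (s j) w))%R).
    by rewrite ler_pM2l// mulr_gt0.
  rewrite (_ : dl * zeta i w * (n%:R * Ys l (s j) w) = n%:R * dl * zeta i w * Ys l (s j) w)%R;
    last by ring.
  apply: (@le_lt_trans _ _ (Ys l (s j) w)); first by rewrite ler_piMl// ltW.
  by rewrite mulrA ltr_pMl.
have sumD : \sum_(l <oo) \sum_(m <oo) P (D l m) <= P concurrence.
  under eq_eseriesr => l _.
    rewrite nneseries_measure_bigcup//; last first.
      by move=> m m' _ _ [w [[_ g _] [_ g' _]]]; exact: grid_uniq g g'.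
    over.
  rewrite nneseries_measure_bigcup//; last 2 first.
  - by move=> l; exact: bigcupT_measurable.
  (* Two distinct indices would each strictly beat the other at the first site. *)
  - move=> l l' _ _ [w [[m _ Dlm] [m' _ Dlm']]]; apply/eqP; apply: contraT => ll'.
    have := lt_trans (Dlt _ _ _ Dlm l' (Ordinal k0) _) (Dlt _ _ _ Dlm' l (Ordinal k0) ll').
    by rewrite ltxx eq_sym => /(_ ll').
  apply: le_measure; rewrite ?inE//.
    by apply: bigcupT_measurable => l; exact: bigcupT_measurable.
  rewrite concurrenceE => w [l _ [m _ Dlm]]; exists l => // j i.
  by have [->//|il] := eqVneq i l; rewrite ltW//; exact: Dlt Dlm _ _ il.
apply: (@le_trans _ _ ((expR dl)%:E * \sum_(l <oo) \sum_(m <oo) P (D l m) + dl%:E)); last first.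
  by rewrite leeD2r// lee_pmul2l ?lte_fin ?expR_gt0.
rewrite (sum_extremal (fun m => m.+1%:R)%R (fun _ n => n%:R)%R mB).
set T := fun y => \sum_(m <oo) _.
have T0 y : 0 <= T y by apply: nneseries_ge0 => m _ _; exact: nneseries_ge0.
have mT : measurable_fun setT T.
  apply: ge0_emeasurable_sum => [m y _ _|m _]; first exact: nneseries_ge0.
  by apply: ge0_emeasurable_sum => // l _;
    exact: (measurable_extremal_prob mY eta_repr s_in_X dl0 _ _ _ l mB).
have -> : (expR dl)%:E * \int[Q]_y T y + dl%:E = \int[Q]_y ((expR dl)%:E * T y + dl%:E).
  rewrite ge0_integralD//; last 3 first.
  - by move=> y _; rewrite mule_ge0// lee_fin expR_ge0.
  - exact: measurable_funeM.
  - by move=> y _; rewrite lee_fin ltW.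
  by rewrite ge0_integralZl_EFin ?expR_ge0// integral_cst// [X in _ + _ * X]probability_setT
    mule1.
apply: ge0_le_integral => //.
- by move=> y _; rewrite inve_ge0.
- by apply: emeasurable_funD => //; exact: measurable_funeM.
move=> y _; have [By|nB] := pselect (B (Y ^~ y)).
  apply: le_trans (sumF_lower By) _; rewrite leeD2r// lee_pmul2l ?lte_fin ?expR_gt0//.
  apply: lee_nneseries => [m _ _|m _]; first exact: nneseries_ge0.
  by rewrite (extremal_prob_eq _ _ _ By).
(* A path vanishing at some [s j] has an infinite inner expectation and contributes 0 on the
   left. *)
move/existsNP : nB => [j /negP]; rewrite -leNgt => Yj.
rewrite (@c_infty y j) ?invey; last by apply/eqP; rewrite eq_le Yj Y0.
by rewrite adde_ge0 ?mule_ge0// lee_fin ?expR_ge0// ltW.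
Qed.

Lemma concurrence_bounds :
  P concurrence <= (expR (3 * dl))%:E * (dl%:E + I) /\
  I <= (expR dl)%:E * P concurrence + dl%:E.
Proof. by split. Qed.

End fixed_mesh.

End concurrence.

(** * Letting the mesh tend to 0 *)

Lemma le_mesh_limit (R : realType) (x y : \bar R) (e : R) : 0 <= x -> 0 <= y -> (0 < e)%R ->
  (forall dl : R, (0 < dl)%R -> x <= (expR (e * dl))%:E * (dl%:E + y)) -> x <= y.
Proof.
move=> x0 y0 e0 xy; case: y y0 xy => [y y0 xy|_ _|//]; last by rewrite leey.
have cvg_y : (fun n => expR (e * n.+1%:R^-1) * (n.+1%:R^-1 + y))%R @ \oo -->
    (expR (e * 0) * (0 + y))%R.
  have h : (fun n : nat => n.+1%:R^-1)%R @ \oo --> (0 : R)%R by exact: cvg_harmonic.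
  apply: cvgM; last by apply: cvgD => //; exact: cvg_cst.
  by apply: continuous_cvg; [exact: continuous_expR|apply: cvgMr].
rewrite mulr0 expR0 mul1r add0r in cvg_y.
have cvg_yE : (fun n => (expR (e * n.+1%:R^-1) * (n.+1%:R^-1 + y))%:E) @ \oo --> y%:E.
  by apply: cvg_EFin => //; apply: nearW.
rewrite -(cvg_lim _ cvg_yE)//; apply: lime_ge; first by apply/cvg_ex; exists y%:E.
by apply: nearW => n; rewrite EFinM EFinD; apply: xy.
Qed.

Unset Implicit Arguments.

Theorem theorem2 (R : realType) (dim : nat) (dim_ge1 : (1 <= dim)%N)
    (X : set 'rV[R]_dim) (X_compact : compact X)
    (dO : measure_display) (Omega : measurableType dO)
    (P : probability Omega R)
    (zeta : nat -> Omega -> R) (Ys : nat -> 'rV[R]_dim -> Omega -> R)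
    (dY : measure_display) (TY : measurableType dY) (Q : probability TY R)
    (Y : 'rV[R]_dim -> TY -> R)
    (dYt : measure_display) (TYt : measurableType dYt)
    (Qt : probability TYt R) (Yt : 'rV[R]_dim -> TYt -> R)
    (Y_spectral : spectral_process X Q Y)
    (Yt_copy : is_copy X Qt Yt Q Y)
    (eta_repr : spectral_representation X P zeta Ys Q Y)
    (k : nat) (k_ge2 : (2 <= k)%N)
    (s : 'I_k -> 'rV[R]_dim) (s_in_X : forall j, X (s j)) :
  concurrence_probability P zeta Ys s =
  \int[Q]_w (\int[Qt]_v
     \big[maxe/-oo]_(j < k) ((Yt (s j) v)%:E / (Y (s j) w)%:E))^-1.
Proof.
have k0 : (0 < k)%N by exact: ltnW.
have bounds dl (dl0 : (0 < dl)%R) :=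
  concurrence_bounds Y_spectral Yt_copy eta_repr k0 s_in_X dl0.
set I := \int[Q]_w _; rewrite /concurrence_probability.
set p := P _.
have p0 : 0 <= p by exact: measure_ge0.
have I0 : 0 <= I.
  apply: integral_ge0 => y _; rewrite inve_ge0; apply: integral_ge0 => v _.
  case: Y_spectral Yt_copy => [[_ Y0 _] _ _] [[_ Yt0 _] _].
  by apply: max_ratio_ge0 => // j; [exact: Yt0|exact: Y0].
apply/eqP; rewrite eq_le; apply/andP; split.
  apply: (@le_mesh_limit _ _ _ 3) => // dl dl0.
  by have [] := bounds dl dl0.
apply: (@le_mesh_limit _ _ _ 1) => // dl dl0.
have [_] := bounds dl dl0; move/le_trans; apply.
(* The additive [dl] is enlarged to exp(dl) dl to fit the form of [le_mesh_limit]. *)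
rewrite mul1r muleDr// addeC leeD2r// -EFinM lee_fin ler_peMl ?ltW//.
by rewrite -expR0 ltr_expR.
Qed.
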